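(* Let $\mathcal H=\mathbb R^N$ and suppose one of the following holds: (i) $f(x)=x^\top Ax+\iota_{C}(x)$, $g(x)=x^\top Bx$, and $S=\mathbb R^N$, where $A$ and $B$ are symmetric positive definite $N\times N$ matrices and $C:=\{x\in\mathbb R^N:\|x\|=1\}$ is the Euclidean unit sphere; (ii) $f(x)=\|x\|_1$, $g(x)=\|x\|_2$, and $S=\{x\in\mathbb R^N: Ax\le b,\ Cx=d\}$, where $A\in\mathbb R^{M_0\times N}$, $b\in\mathbb R^{M_0}$, $C\in\mathbb R^{P\times N}$, $d\in\mathbb R^P$, and $S$ is nonempty, bounded and does not contain the origin. Then, for all $c\in[0,+\infty)$, the function $h(x,y)=\frac{f(x)}{g(x)}+\iota_S(x)+c\|x-y\|^2$ satisfies the KL property with an exponent of $1/2$ at $(\overline x,\overline x)$ for all $\overline x\in S\cap\operatorname{dom}f$. Consequently, if $(x_n)_{n\in\mathbb N}$ is generated by the e-PSG algorithm described in the context with $\liminf_{n\to\infty}\tau_n=\overline\tau>0$, then it converges linearly: $(x_n)_{n\in\mathbb N}$ converges to some $x_\infty$ and, with $c=\frac{\ell\overline\kappa^2}{2m}+\frac{\overline\mu}{2\sqrt{mM}}$ in the definition of $h$, there exist $\gamma_1,\gamma_2>0$ and $\rho\in(0,1)$ such that, for all $n\in\mathbb N$, $|h(x_{n+1},x_n)-h(x_\infty,x_\infty)|\le\gamma_1\rho^n$ and $\|x_n-x_\infty\|\le\gamma_2\rho^{n/2}$.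
   Context: $\|\cdot\|=\|\cdot\|_2$ is the Euclidean norm and $\|\cdot\|_1$ the $\ell_1$-norm on $\mathbb R^N$; $\mathbb N=\{0,1,2,\dots\}$. $\iota_D$ is the indicator function of a set $D$ ($0$ on $D$, $+\infty$ off $D$); $\operatorname{dom}f=\{x:f(x)<+\infty\}$; $h(x,y)=+\infty$ whenever $x\notin S\cap\operatorname{dom}f$. Subdifferentials: for $h$ finite at $z$, the Fréchet subdifferential is $\widehat\partial h(z)=\{u:\liminf_{w\to z}\frac{h(w)-h(z)-\langle u,w-z\rangle}{\|w-z\|}\ge0\}$, and the limiting subdifferential $\partial_Lh(z)$ is the set of all $u$ for which there exist $z_n\to z$ with $h(z_n)\to h(z)$ and $u_n\in\widehat\partial h(z_n)$ with $u_n\to u$; both are $\varnothing$ where $h$ is not finite. $h$ has the KL property at $\overline z$ (a point with $\partial_Lh(\overline z)\ne\varnothing$) with an exponent of $\alpha\in[0,1)$ if there exist a neighborhood $U$ of $\overline z$, $\eta\in(0,+\infty]$ and $\gamma>0$ such that, with $\varphi(s)=\gamma s^{1-\alpha}$, $\varphi'(h(z)-h(\overline z))\operatorname{dist}(0,\partial_Lh(z))\ge1$ for all $z\in U$ with $h(\overline z)<h(z)<h(\overline z)+\eta$. e-PSG algorithm (for $\min_{x\in S}f(x)/g(x)$). Write $f=f^{\mathfrak s}+f^{\mathfrak n}$ with $f^{\mathfrak s}(x)=x^\top Ax$, $f^{\mathfrak n}=\iota_C$ in case (i), and $f^{\mathfrak s}\equiv0$, $f^{\mathfrak n}=\|\cdot\|_1$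 in case (ii); $\nabla f^{\mathfrak s}$ is Lipschitz continuous with modulus $\ell$. Let $m,M>0$ be such that $m\le g(x)\le M$ for all $x\in S\cap\operatorname{dom}f$. (In both cases $g$ is convex, i.e. weakly convex with modulus $\beta=0$, and the algorithm's parameters are stated here with $\beta=0$.) Choose $x_{-1}=x_0\in S\cap\operatorname{dom}f$, $\delta>0$, $$\overline\mu\in\left[0,\frac{\delta\sqrt{mM}}{2M}\right),\qquad\overline\kappa\in\left[0,\sqrt{\frac{m\delta}{\ell M}-\frac{2m\overline\mu}{\ell\sqrt{mM}}}\right)$$ (if $\ell=0$, the upper bound for $\overline\kappa$ is read as $+\infty$). For $n=0,1,2,\dots$: set $\theta_n=\frac{f(x_n)}{g(x_n)}$, $g_n=\nabla g(x_n)$, choose $\tau_n$ with $0<\tau_n\le1/\delta$, let $u_n=x_n+\kappa_n(x_n-x_{n-1})$ with $\kappa_n\in[0,\overline\kappa]$, $v_n=x_n+\mu_n(x_n-x_{n-1})$ with $\mu_n\in[0,\overline\mu\tau_n]$, and find $$x_{n+1}\in\operatorname*{argmin}_{x\in S}\left(f^{\mathfrak n}(x)+f^{\mathfrak s}(u_n)+\langle\nabla f^{\mathfrak s}(u_n),x-u_n\rangle+\frac1{2\tau_n}\|x-v_n-\tau_n\theta_ng_n\|^2+\frac\ell2\|x-u_n\|^2\right).$$ The sequence is assumed to be infinite (the algorithm is run without termination). *)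

(* Defs.v *)
From HB Require Import structures.
From mathcomp Require Export all_boot all_order all_algebra.
From mathcomp Require Export all_classical all_reals all_analysis.
Export numFieldNormedType.Exports.
Import Order.TTheory GRing.Theory Num.Theory.

Set Implicit Arguments.
Unset Strict Implicit.
Unset Printing Implicit Defensive.

Local Open Scope classical_set_scope.
Local Open Scope ring_scope.

(* R^n is 'cV[R]_n. The library norm `|x| on matrices is the sup norm; it
   induces the usual topology, so convergence, neighborhoods, directional
   derivatives and boundedness below are the library's, while every metric
   quantity uses norm2 (or norm1). *)

Definition dotv (R : realType) (n : nat) (u v : 'cV[R]_n) : R :=
  (u^T *m v) 0 0.

Definition norm2 (R : realType) (n : nat) (x : 'cV[R]_n) : R :=
  Num.sqrt (dotv x x).

Definition norm1 (R : realType) (n : nat) (x : 'cV[R]_n) : R :=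
  \sum_(i < n) `|x i 0|.

Definition qform (R : realType) (n : nat) (A : 'M[R]_n) (x : 'cV[R]_n) : R :=
  (x^T *m A *m x) 0 0.

Definition sym_posdef (R : realType) (n : nat) (A : 'M[R]_n) : Prop :=
  A^T = A /\ forall x : 'cV[R]_n, x != 0 -> 0 < qform A x.

Definition grad (R : realType) (n : nat) (f : 'cV[R]_n -> R) (x : 'cV[R]_n) :
  'cV[R]_n := \col_i 'D_(delta_mx i 0) f x.

Definition sphere (R : realType) (n : nat) : set 'cV[R]_n :=
  [set x | norm2 x = 1].

Definition iota_ (R : realType) (T : Type) (D : set T) (x : T) : \bar R :=
  if x \in D then 0%E else +oo%E.

Definition dom (R : realType) (T : Type) (f : T -> \bar R) : set T :=
  [set x | (f x < +oo)%E].

Definition argmin (R : realType) (T : Type) (D : set T) (F : T -> \bar R) :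
  set T := [set x | D x /\ forall y, D y -> (F x <= F y)%E].

(* The distance to the empty set is +oo. *)
Definition edist (R : realType) (n : nat) (a : 'cV[R]_n) (D : set 'cV[R]_n) :
  \bar R := ereal_inf [set (norm2 (u - a))%:E | u in D].

Definition frechet_subdiff (R : realType) (n : nat) (h : 'cV[R]_n -> \bar R)
    (z : 'cV[R]_n) : set 'cV[R]_n :=
  [set u | h z \is a fin_num /\
    (0 <= limf_einf (fun w : 'cV[R]_n =>
            (h w - h z - (dotv u (w - z))%:E) * ((norm2 (w - z))^-1)%:E)
          z^')%E].

Definition limiting_subdiff (R : realType) (n : nat) (h : 'cV[R]_n -> \bar R)
    (z : 'cV[R]_n) : set 'cV[R]_n :=
  [set u | h z \is a fin_num /\
    exists (z_ u_ : nat -> 'cV[R]_n),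
      [/\ z_ k @[k --> \oo] --> z,
          h (z_ k) @[k --> \oo] --> h z,
          forall k, frechet_subdiff h (z_ k) (u_ k) &
          u_ k @[k --> \oo] --> u]].

Definition KL_fun (R : realType) (gamma alpha s : R) : R :=
  gamma * s `^ (1 - alpha).

(* Both values of h under fine are finite: zbar has a limiting subgradient,
   and h zbar < h z < h zbar + eta. *)
Definition KL_property (R : realType) (n : nat) (h : 'cV[R]_n -> \bar R)
    (zbar : 'cV[R]_n) (alpha : R) : Prop :=
  [/\ 0 <= alpha < 1,
      limiting_subdiff h zbar !=set0 &
      exists (U : set 'cV[R]_n) (eta : \bar R) (gamma : R),
        [/\ nbhs zbar U, (0 < eta)%E, 0 < gamma &
          forall z, U z -> (h zbar < h z)%E -> (h z < h zbar + eta)%E ->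
            (1 <= (derive1 (KL_fun gamma alpha) (fine (h z) - fine (h zbar)))%:E
                  * edist 0 (limiting_subdiff h z))%E]].

(* The product R^N x R^N with its Euclidean structure is R^(N + N). *)
Definition on_col_mx (R : realType) (N : nat)
    (h : 'cV[R]_N -> 'cV[R]_N -> \bar R) (z : 'cV[R]_(N + N)) : \bar R :=
  h (usubmx z) (dsubmx z).

(* The explicit test gives +oo off S and dom f; without it, g x = 0 would be
   a problem, since x^-1 = 0 at x = 0 and +oo * 0 = 0 in \bar R. *)
Definition merit (R : realType) (N : nat) (f : 'cV[R]_N -> \bar R)
    (g : 'cV[R]_N -> R) (S : set 'cV[R]_N) (c : R) (x y : 'cV[R]_N) : \bar R :=
  if x \in S `&` dom f then
    (f x * ((g x)^-1)%:E + iota_ R S x + (c * norm2 (x - y) ^+ 2)%:E)%E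
  else +oo%E.

Definition quadratic_case (R : realType) (N : nat) (f : 'cV[R]_N -> \bar R)
    (fs : 'cV[R]_N -> R) (fn : 'cV[R]_N -> \bar R) (g : 'cV[R]_N -> R)
    (S : set 'cV[R]_N) : Prop :=
  exists A B : 'M[R]_N, sym_posdef A /\ sym_posdef B /\
    [/\ f = (fun x => (qform A x)%:E + iota_ R (@sphere R N) x)%E,
        fs = qform A,
        fn = iota_ R (@sphere R N),
        g = qform B &
        S = setT].

Definition sparse_case (R : realType) (N : nat) (f : 'cV[R]_N -> \bar R)
    (fs : 'cV[R]_N -> R) (fn : 'cV[R]_N -> \bar R) (g : 'cV[R]_N -> R)
    (S : set 'cV[R]_N) : Prop :=
  exists (M0 P : nat) (A : 'M[R]_(M0, N)) (b : 'cV[R]_M0)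
         (C : 'M[R]_(P, N)) (d : 'cV[R]_P),
    [/\ f = (fun x => (norm1 x)%:E),
        fs = (fun=> 0),
        fn = (fun x => (norm1 x)%:E),
        g = @norm2 R N &
        S = [set x | (forall i, (A *m x) i 0 <= b i 0) /\ C *m x = d]] /\
    [/\ S !=set0, bounded_set S & ~ S 0].

Definition lipschitz_grad (R : realType) (N : nat) (fs : 'cV[R]_N -> R)
    (ell : R) : Prop :=
  0 <= ell /\
  forall x y, norm2 (grad fs x - grad fs y) <= ell * norm2 (x - y).

Definition ePSG_parameters (R : realType) (ell m M delta mubar kappabar : R) :
    Prop :=
  [/\ 0 < delta,
      0 <= mubar < delta * Num.sqrt (m * M) / (2 * M),
      0 <= kappabar &
      0 < ell ->
        kappabar < Num.sqrt (m * delta / (ell * M)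
                             - 2 * m * mubar / (ell * Num.sqrt (m * M)))].

Definition ePSG_objective (R : realType) (N : nat) (fs : 'cV[R]_N -> R)
    (fn : 'cV[R]_N -> \bar R) (ell tau theta : R) (u v gr x : 'cV[R]_N) :
    \bar R :=
  (fn x + (fs u + dotv (grad fs u) (x - u)
           + (2 * tau)^-1 * norm2 (x - v - (tau * theta) *: gr) ^+ 2
           + ell / 2 * norm2 (x - u) ^+ 2)%:E)%E.

(* At n = 0, n.-1 = 0 stands for the index -1: x_(-1) = x_0. *)
Definition ePSG_sequence (R : realType) (N : nat) (f : 'cV[R]_N -> \bar R)
    (fs : 'cV[R]_N -> R) (fn : 'cV[R]_N -> \bar R) (g : 'cV[R]_N -> R)
    (S : set 'cV[R]_N) (ell delta mubar kappabar : R)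
    (tau kappa mu : nat -> R) (x_ : nat -> 'cV[R]_N) : Prop :=
  (S `&` dom f) (x_ 0%N) /\
  forall n : nat,
    let theta := fine (f (x_ n)) / g (x_ n) in
    let u := x_ n + kappa n *: (x_ n - x_ n.-1) in
    let v := x_ n + mu n *: (x_ n - x_ n.-1) in
    [/\ 0 < tau n <= delta^-1,
        0 <= kappa n <= kappabar,
        0 <= mu n <= mubar * tau n &
        argmin S (ePSG_objective fs fn ell (tau n) theta u v (grad g (x_ n)))
          (x_ n.+1)].

(* Main.v *)
(* Write r = f/g on its domain. A Frechet subgradient (a, b) of h at (x, y)
   satisfies |b| >= 2c|x - y|, and a + b is a Frechet subgradient of r at x.
   Hence the KL inequality with exponent 1/2 follows from a bound
   r(x) - r(xb) <= K |v|^2 for all Frechet subgradients v of r at x near xb.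

   In case (i) r is the Rayleigh quotient of (A, B); testing v against a curve
   on the sphere gives |A x - r(x) B x| <= K |v|, and the bound follows from
   |x^T Q x| <= K |Q x|^2 for the symmetric matrix Q = A - r(xb) B.

   In case (ii), on the points of S with given signs and given active
   constraints, r^2 is the Rayleigh quotient of (s s^T, I), s being the sign
   vector, restricted to an affine subspace. The same argument applies in that
   subspace, and there are finitely many such pieces.

   Along e-PSG, H_n = h(x_n, x_(n-1)) decreases by at least a multiple of
   |x_n - x_(n-1)|^2, and r has a subgradient at x_(n+1) bounded by the last two
   steps. Since the domain is compact and r(x_n) has the limit L of H_n, the KL
   bound holds along the sequence with one constant, and it gives
   H_(n+2) - L <= q (H_n - L) with q < 1. The steps then decay geometrically. *)

Require Import Defs.
From mathcomp Require Import ring lra.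
Import Order.TTheory GRing.Theory Num.Theory.

Set Implicit Arguments.
Unset Strict Implicit.
Unset Printing Implicit Defensive.

Local Open Scope classical_set_scope.
Local Open Scope ring_scope.

(** * Euclidean norm and quadratic forms *)

(** With exponent 1/2 the desingularizing function is [gamma * Num.sqrt s], so the KL inequality
    says that the increase of h over its value at the base point is at most [(gamma / 2) ^+ 2] times
    the squared distance. Such a bound passes to limits, so Frechet subgradients suffice. No
    subdifferential calculus is used: a subgradient is tested on curves in the domain, known up to
    an error of order two. The exponent comes from r(x) - r(xb) being, up to the denominator, the
    value at x of a fixed quadratic form Q. The obstacle is that the residual given by a subgradient
    contains r(x) where Q contains r(xb). The discrepancy is proportional to r(x) - r(xb), so its
    square is absorbed on the left when x is near xb. In case (ii) the l1 norm is linear only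
    piecewise; the piece to use is that of x, which varies, while xb may lie only in its closure.
    For e-PSG the limit point is unknown when the KL constant is needed; only the limit of the
    values is known, hence the compactness argument. *)

Section euclidean.
Variable R : realType.
Implicit Types n k : nat.

Lemma dotvE n (u v : 'cV[R]_n) : dotv u v = \sum_i u i 0 * v i 0.
Proof. by rewrite /dotv mxE; apply: eq_bigr => i _; rewrite mxE. Qed.

Lemma dotvC n (u v : 'cV[R]_n) : dotv u v = dotv v u.
Proof. by rewrite !dotvE; apply: eq_bigr => i _; rewrite mulrC. Qed.

Lemma dotvDr n (u v w : 'cV[R]_n) : dotv u (v + w) = dotv u v + dotv u w.
Proof. by rewrite /dotv mulmxDr mxE. Qed.

Lemma dotvZr n a (u v : 'cV[R]_n) : dotv u (a *: v) = a * dotv u v.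
Proof. by rewrite /dotv -scalemxAr mxE. Qed.

Lemma dotvNr n (u v : 'cV[R]_n) : dotv u (- v) = - dotv u v.
Proof. by rewrite -scaleN1r dotvZr mulN1r. Qed.

Lemma dotvDl n (u v w : 'cV[R]_n) : dotv (u + v) w = dotv u w + dotv v w.
Proof. by rewrite dotvC dotvDr !(dotvC w). Qed.

Lemma dotvZl n a (u v : 'cV[R]_n) : dotv (a *: u) v = a * dotv u v.
Proof. by rewrite dotvC dotvZr dotvC. Qed.

Lemma dotvNl n (u v : 'cV[R]_n) : dotv (- u) v = - dotv u v.
Proof. by rewrite dotvC dotvNr dotvC. Qed.

Lemma dotv0r n (u : 'cV[R]_n) : dotv u 0 = 0.
Proof. by rewrite /dotv mulmx0 mxE. Qed.

Lemma dotv0l n (u : 'cV[R]_n) : dotv 0 u = 0.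
Proof. by rewrite dotvC dotv0r. Qed.

Definition dotv_lin := (dotvDl, dotvDr, dotvNl, dotvNr, dotvZl, dotvZr).

Lemma dotv_mull n k (A : 'M[R]_(n, k)) u v :
  dotv (A *m u) v = dotv u (A^T *m v).
Proof. by rewrite /dotv trmx_mul mulmxA. Qed.

Lemma coord_dotv n (x : 'cV[R]_n) i : x i 0 = dotv (delta_mx i 0) x.
Proof. by rewrite /dotv trmx_delta -rowE mxE. Qed.

Lemma dotv_ge0 n (u : 'cV[R]_n) : 0 <= dotv u u.
Proof. by rewrite dotvE sumr_ge0// => i _; rewrite -expr2 sqr_ge0. Qed.

Lemma norm2_ge0 n (u : 'cV[R]_n) : 0 <= norm2 u.
Proof. exact: sqrtr_ge0. Qed.

Lemma norm2_sqr n (u : 'cV[R]_n) : norm2 u ^+ 2 = dotv u u.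
Proof. by rewrite sqr_sqrtr// dotv_ge0. Qed.

Lemma norm2_eq0 n (u : 'cV[R]_n) : (norm2 u == 0) = (u == 0).
Proof.
apply/idP/eqP => [|->]; last by rewrite /norm2 dotv0r sqrtr0.
rewrite -sqrf_eq0 norm2_sqr dotvE psumr_eq0; last first.
  by move=> i _; rewrite -expr2 sqr_ge0.
move=> /allP u0; apply/colP => i; rewrite mxE.
by have := u0 i (mem_index_enum _); rewrite mulf_eq0 orbb => /eqP.
Qed.

Lemma norm2_0 n : norm2 (0 : 'cV[R]_n) = 0.
Proof. by apply/eqP; rewrite norm2_eq0. Qed.

Lemma norm2_gt0 n (u : 'cV[R]_n) : (0 < norm2 u) = (u != 0).
Proof. by rewrite lt_neqAle eq_sym norm2_eq0 norm2_ge0 andbT. Qed.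

Lemma norm2Z n a (u : 'cV[R]_n) : norm2 (a *: u) = `|a| * norm2 u.
Proof.
by rewrite /norm2 dotv_lin dotvZr mulrA -expr2 sqrtrM ?sqr_ge0// sqrtr_sqr.
Qed.

Lemma norm2N n (u : 'cV[R]_n) : norm2 (- u) = norm2 u.
Proof. by rewrite -scaleN1r norm2Z normrN1 mul1r. Qed.

Lemma norm2B n (u v : 'cV[R]_n) : norm2 (u - v) = norm2 (v - u).
Proof. by rewrite -norm2N opprB. Qed.

Lemma dotv_le n (u v : 'cV[R]_n) : dotv u v <= norm2 u * norm2 v.
Proof.
have [->|u0] := eqVneq u 0; first by rewrite dotv0l norm2_0 mul0r.
have [->|v0] := eqVneq v 0; first by rewrite dotv0r norm2_0 mulr0.
have up : 0 < norm2 u by rewrite norm2_gt0.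
have vp : 0 < norm2 v by rewrite norm2_gt0.
(* Expanded, this square is twice [norm2 u * norm2 v] times the gap in the inequality. *)
have := dotv_ge0 (norm2 v *: u - norm2 u *: v).
rewrite !dotv_lin -!norm2_sqr (dotvC v u) => h.
have : 0 <= (2 * (norm2 u * norm2 v)) * (norm2 u * norm2 v - dotv u v).
  by apply: le_trans h _; rewrite le_eqVlt; apply/orP; left; apply/eqP; ring.
by rewrite pmulr_rge0 ?subr_ge0// mulr_gt0// mulr_gt0.
Qed.

Lemma dotv_abs_le n (u v : 'cV[R]_n) : `|dotv u v| <= norm2 u * norm2 v.
Proof.
by rewrite ler_norml dotv_le andbT lerNl -dotvNl -(norm2N u) dotv_le.
Qed.

Lemma norm2_le n (u : 'cV[R]_n) a :
  0 <= a -> (norm2 u <= a) = (dotv u u <= a ^+ 2).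
Proof. by move=> a0; rewrite -norm2_sqr ler_sqr// nnegrE ?norm2_ge0. Qed.

Lemma ler_norm2D n (u v : 'cV[R]_n) : norm2 (u + v) <= norm2 u + norm2 v.
Proof.
rewrite norm2_le ?addr_ge0 ?norm2_ge0// !dotv_lin -!norm2_sqr (dotvC v u).
by have := dotv_le u v; rewrite sqrrD; lra.
Qed.

Lemma ler_norm2B n (u v : 'cV[R]_n) : norm2 (u - v) <= norm2 u + norm2 v.
Proof. by rewrite (le_trans (ler_norm2D _ _))// norm2N. Qed.

Lemma ler_dist_norm2 n (u v : 'cV[R]_n) :
  `|norm2 u - norm2 v| <= norm2 (u - v).
Proof.
rewrite ler_norml; apply/andP; split.
  by rewrite lerNl opprB lerBlDr norm2B (le_trans _ (ler_norm2D _ _))// subrK.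
by rewrite lerBlDr (le_trans _ (ler_norm2D _ _))// subrK.
Qed.

Lemma norm2_coord n (u : 'cV[R]_n) i : `|u i 0| <= norm2 u.
Proof.
rewrite -ler_sqr ?nnegrE ?norm2_ge0// norm2_sqr dotvE real_normK ?num_real//.
rewrite (bigD1 i)//= -expr2 lerDl sumr_ge0// => j _.
by rewrite -expr2 sqr_ge0.
Qed.

Lemma norm2_le_norm1 n (u : 'cV[R]_n) : norm2 u <= norm1 u.
Proof.
have n1 : 0 <= norm1 u by exact: sumr_ge0.
rewrite norm2_le// expr2 {1}/norm1 big_distrl/= dotvE ler_sum// => i _.
rewrite (le_trans (ler_norm _))// normrM ler_wpM2l//.
by rewrite /norm1 (bigD1 i)//= lerDl sumr_ge0.
Qed.

Lemma norm1_le_norm2 n (u : 'cV[R]_n) : norm1 u <= n%:R * norm2 u.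
Proof.
rewrite (le_trans (ler_sum _ (fun i _ => norm2_coord u i)))//.
by rewrite sumr_const card_ord mulr_natl.
Qed.

Lemma ler_norm1D n (u v : 'cV[R]_n) : norm1 (u + v) <= norm1 u + norm1 v.
Proof. by rewrite -big_split/= ler_sum// => i _; rewrite mxE ler_normD. Qed.

Lemma norm_le_norm2 n (u : 'cV[R]_n) : `|u| <= norm2 u.
Proof.
rewrite [leLHS]/Num.Def.normr/= mx_normrE; apply/bigmax_leP; split.
  exact: norm2_ge0.
by move=> [i j] _ /=; rewrite (ord1 j) norm2_coord.
Qed.

Lemma norm2_le_norm n (u : 'cV[R]_n) : norm2 u <= n%:R * `|u|.
Proof.
rewrite (le_trans (norm2_le_norm1 u))//.
have -> : n%:R * `|u| = \sum_(i < n) `|u| by rewrite sumr_const card_ord mulr_natl.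
rewrite ler_sum// => i _.
rewrite [leRHS]/Num.Def.normr/= mx_normrE.
by apply: (le_bigmax_cond _ (fun ij : 'I_n * 'I_1 => `|u ij.1 ij.2|) (j := (i, 0))).
Qed.

Lemma nbhs_norm2P n (z : 'cV[R]_n) (P : set 'cV[R]_n) :
  nbhs z P <-> exists2 e : R, 0 < e & forall x, norm2 (x - z) < e -> P x.
Proof.
split=> [/nbhs_ballP[e/= e0 zP]|[e e0 zP]].
  exists e => // x xz; apply: zP => /=.
  by rewrite -ball_normE/= distrC (le_lt_trans (norm_le_norm2 _)).
(* [norm2] is at most [n] times the sup norm; [n.+1] keeps the divisor nonzero when [n = 0]. *)
apply/nbhs_ballP; exists (e / n.+1%:R) => /=; first by rewrite divr_gt0.
move=> x; rewrite -ball_normE/= distrC ltr_pdivlMr// => xz; apply: zP.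
rewrite (le_lt_trans (norm2_le_norm _))// (le_lt_trans _ xz)// mulrC.
by rewrite ler_wpM2l// ler_nat.
Qed.

Lemma cvg_norm2P n (x_ : nat -> 'cV[R]_n) (x : 'cV[R]_n) :
  x_ k @[k --> \oo] --> x <->
  norm2 (x_ k - x) @[k --> \oo] --> (0 : R).
Proof.
split=> [xx|/cvgrPdist_lt xx].
  apply/cvgrPdist_lt => e e0.
  have xe : nbhs x [set y | norm2 (y - x) < e] by apply/nbhs_norm2P; exists e.
  have := xx _ xe; rewrite nbhs_filterE/= => xe'; apply: filterS xe' => k /=.
  by rewrite sub0r normrN ger0_norm ?norm2_ge0.
move=> P /nbhs_norm2P[e e0 xP]; apply: filterS (xx e e0) => k.
by rewrite sub0r normrN ger0_norm ?norm2_ge0// => /xP.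
Qed.

Lemma mulmx_norm2_bound m n (A : 'M[R]_(m, n)) :
  exists2 K : R, 0 < K & forall x, norm2 (A *m x) <= K * norm2 x.
Proof.
exists (1 + \sum_i norm2 (row i A)^T).
  by rewrite ltr_pwDl ?sumr_ge0// => i _; exact: norm2_ge0.
move=> x; rewrite mulrDl mul1r (le_trans (norm2_le_norm1 _))//.
apply: (@le_trans _ _ ((\sum_i norm2 (row i A)^T) * norm2 x)); last first.
  by rewrite lerDr norm2_ge0.
rewrite mulr_suml ler_sum// => i _.
suff -> : (A *m x) i 0 = dotv (row i A)^T x by exact: dotv_abs_le.
by rewrite /dotv trmxK -row_mul [RHS]mxE.
Qed.

Lemma qformE n (A : 'M[R]_n) x : qform A x = dotv x (A *m x).
Proof. by rewrite /qform /dotv mulmxA. Qed.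

Lemma qformD n (A : 'M[R]_n) x d : A^T = A ->
  qform A (x + d) = qform A x + 2 * dotv (A *m x) d + qform A d.
Proof.
move=> As; rewrite !qformE mulmxDr !dotv_lin.
by rewrite (dotvC d (A *m x)) dotv_mull As; ring.
Qed.

Lemma qform_bound n (A : 'M[R]_n) :
  exists2 K : R, 0 < K & forall x, `|qform A x| <= K * norm2 x ^+ 2.
Proof.
have [K K0 KA] := mulmx_norm2_bound A; exists K => // x.
rewrite qformE (le_trans (dotv_abs_le _ _))// mulrC expr2 mulrA.
by rewrite ler_wpM2r// norm2_ge0.
Qed.

Lemma qformZ n (A : 'M[R]_n) a x : qform A (a *: x) = a ^+ 2 * qform A x.
Proof. by rewrite !qformE -scalemxAr !dotv_lin mulrA expr2. Qed.

(* [Q = Q *m pinvmx Q *m Q] exhibits x^T Q x as a quadratic form in Q x. *)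
Lemma qform_mulmx_bound n (Q : 'M[R]_n) : Q^T = Q ->
  exists2 K : R, 0 < K & forall x, `|qform Q x| <= K * norm2 (Q *m x) ^+ 2.
Proof.
move=> Qs; have [K K0 KP] := qform_bound (pinvmx Q); exists K => // x.
suff -> : qform Q x = qform (pinvmx Q) (Q *m x) by exact: KP.
by rewrite /qform trmx_mul Qs -{1}(mulmxKpV (submx_refl Q)) !mulmxA.
Qed.

End euclidean.

(** * Subgradients of the merit function *)

Section subdifferential.
Variable R : realType.
Implicit Types n : nat.

(** The lower limit is a supremum of infima over punctured neighborhoods, so for each [- e] a single
    neighborhood makes the quotient exceed it. Asking for [h w = b%:E] leaves only real arithmetic
    to later proofs. *)
Lemma frechet_subdiff_le n (h : 'cV[R]_n -> \bar R) z u a :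
  h z = a%:E -> frechet_subdiff h z u ->
  forall e, 0 < e -> exists2 rho, 0 < rho & forall w b,
    norm2 (w - z) < rho -> h w = b%:E ->
    a + dotv u (w - z) - e * norm2 (w - z) <= b.
Proof.
move=> hz [_]; rewrite limf_einfE => h0 e e0.
have /ereal_sup_gt[_ [V zV <-] eV] : ((- e)%:E < ereal_sup
    [set ereal_inf [set ((h w - h z - (dotv u (w - z))%:E) *
       ((norm2 (w - z))^-1)%:E)%E | w in V] | V in z^'])%E.
  by rewrite (lt_le_trans _ h0)// lte_fin oppr_lt0.
have /nbhs_norm2P[rho rho0 zrho] := zV.
exists rho => // w b wz hw.
have [wz0|wz0] := eqVneq w z.
  by move: hw; rewrite wz0 subrr dotv0r norm2_0 hz => -[->]; lra.
have p0 : 0 < norm2 (w - z) by rewrite norm2_gt0 subr_eq0.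
have /ereal_inf_lbound/= : [set ((h w - h z - (dotv u (w - z))%:E) *
       ((norm2 (w - z))^-1)%:E)%E | w in V]
    ((h w - h z - (dotv u (w - z))%:E) * ((norm2 (w - z))^-1)%:E)%E.
  by exists w => //; exact: zrho.
move/(lt_le_trans eV); rewrite hw hz lte_fin ltr_pdivlMr//.
by lra.
Qed.

Lemma frechet_subdiff_ge n (h : 'cV[R]_n -> \bar R) z u a :
  h z = a%:E ->
  (forall e, 0 < e -> exists2 rho, 0 < rho & forall w,
    norm2 (w - z) < rho ->
    ((a + dotv u (w - z) - e * norm2 (w - z))%:E <= h w)%E) ->
  frechet_subdiff h z u.
Proof.
move=> hz hw; split; first by rewrite hz.
rewrite limf_einfE; apply/lee_subgt0Pr => e e0; rewrite sub0e.
have [rho rho0 zrho] := hw e e0.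
apply: (@le_trans _ _ (ereal_inf [set ((h w - h z - (dotv u (w - z))%:E) *
       ((norm2 (w - z))^-1)%:E)%E | w in
       [set w | w != z /\ norm2 (w - z) < rho]])); last first.
  apply: ereal_sup_ubound; eexists; last by [].
  by apply/nbhs_norm2P; exists rho => // x xz /= xz'; split.
apply: le_ereal_inf_tmp => _ [w [wz wrho] <-].
have p0 : 0 < norm2 (w - z) by rewrite norm2_gt0 subr_eq0.
have := zrho w wrho; rewrite hz.
case: (h w) => [b| |]//=.
  rewrite !lee_fin ler_pdivlMr//; lra.
by move=> _; rewrite gt0_mulye ?lte_fin ?invr_gt0// leey.
Qed.

(** The Frechet subdifferential of [r] plus the indicator of [D], in epsilon form and with real
    values only. *)
Definition regular_subgradient n (r : 'cV[R]_n -> R) (D : set 'cV[R]_n)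
    (x v : 'cV[R]_n) : Prop :=
  D x /\ forall e, 0 < e -> exists2 rho, 0 < rho & forall y, D y ->
    norm2 (y - x) < rho ->
    r x + dotv v (y - x) - e * norm2 (y - x) <= r y.

(** Put [y = x + e *: t] plus an error of order [e ^+ 2] into the subgradient inequality, divide by
    [e] and let [e] tend to 0. The error allows the curve to be bent back onto the sphere. *)
Lemma regular_subgradient_curve n (r : 'cV[R]_n -> R) D x v t a C e0 :
  regular_subgradient r D x v -> 0 <= C -> 0 < e0 ->
  (forall e, 0 < e <= e0 -> exists y, [/\ D y,
    norm2 (y - x - e *: t) <= C * e ^+ 2 & r y <= r x + e * a + C * e ^+ 2]) ->
  dotv v t <= a.
Proof.
move=> [Dx rv] C0 e00 curve; apply/ler_addgt0Pr => eta eta0.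
pose e1 := eta / 2 / (norm2 t + 1).
have t0 := norm2_ge0 t; have v0 := norm2_ge0 v.
have t1 : 0 < norm2 t + 1 by lra.
have e10 : 0 < e1 by rewrite !divr_gt0.
have [rho rho0 rvrho] := rv _ e10.
pose K := C + norm2 v * C + e1 * C.
have K0 : 0 <= K by rewrite !addr_ge0// mulr_ge0// ltW.
have CK : C <= K by rewrite /K -addrA lerDl addr_ge0// mulr_ge0// ltW.
(* [K] collects the coefficients of [e ^+ 2]. The four bounds on [e] keep it in the range of the
   curve, make [e * K] at most [eta / 2], give [e ^+ 2 <= e], and place [y] within [rho] of [x]. *)
pose e := Num.min e0 (Num.min (eta / 2 / (K + 1))
  (Num.min 1 (rho / (norm2 t + C + 1)))).
have K1 : 0 < K + 1 by lra.
have tC1 : 0 < norm2 t + C + 1 by lra.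
have e_gt0 : 0 < e by rewrite /e !lt_min e00 ltr01 !divr_gt0.
have /and4P[ee0 eeta ele1 erho] : [&& e <= e0, e <= eta / 2 / (K + 1), e <= 1 &
    e <= rho / (norm2 t + C + 1)].
  by have := lexx e; rewrite {2}/e !le_min.
move: eeta erho; rewrite !ler_pdivlMr// => eeta erho.
have [|y [Dy yx ry]] := curve e; first by rewrite e_gt0.
pose s := y - x - e *: t.
have yxE : y - x = e *: t + s by rewrite /s [RHS]addrC subrK.
have ses : norm2 s <= C * e ^+ 2 by [].
clearbody s.
have e2e : e ^+ 2 <= e by rewrite expr2 ger_pMr.
have yxn : norm2 (y - x) <= e * norm2 t + C * e ^+ 2.
  rewrite yxE (le_trans (ler_norm2D _ _))// norm2Z gtr0_norm//.
  by rewrite lerD2l.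
have yrho : norm2 (y - x) < rho.
  apply: (le_lt_trans yxn).
  have : C * e ^+ 2 <= C * e by rewrite ler_wpM2l.
  nra.
have := le_trans (rvrho y Dy yrho) ry.
rewrite {1}yxE !dotv_lin => h.
have vs : - (norm2 v * (C * e ^+ 2)) <= dotv v s.
  rewrite lerNl -dotvNl (le_trans (dotv_le _ _))// norm2N.
  by rewrite ler_wpM2l.
have e1n : e1 * norm2 (y - x) <= e1 * (e * norm2 t + C * e ^+ 2).
  by rewrite ler_wpM2l// ltW.
have e1t : e1 * norm2 t <= eta / 2.
  have -> : eta / 2 = e1 * (norm2 t + 1) by rewrite /e1 divfK// gt_eqF.
  by rewrite ler_wpM2l ?ltW// ltrDl.
have : e * dotv v t <= e * (a + e * K + e1 * norm2 t).
  have -> : e * (a + e * K + e1 * norm2 t) = e * a + C * e ^+ 2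
    + norm2 v * (C * e ^+ 2) + e1 * (e * norm2 t + C * e ^+ 2) by rewrite /K; ring.
  lra.
rewrite ler_pM2l// => h1.
have : e * K <= eta / 2 by lra.
by lra.
Qed.

End subdifferential.

Section KL.
Variable R : realType.

Lemma dotv_col_mx n k (a c : 'cV[R]_n) (b d : 'cV[R]_k) :
  dotv (col_mx a b) (col_mx c d) = dotv a c + dotv b d.
Proof. by rewrite /dotv tr_col_mx mul_row_col mxE. Qed.

Lemma norm2_usubmx n k (u : 'cV[R]_(n + k)) : norm2 (usubmx u) <= norm2 u.
Proof.
rewrite norm2_le ?norm2_ge0// norm2_sqr.
have -> : dotv u u = dotv (usubmx u) (usubmx u) + dotv (dsubmx u) (dsubmx u).
  by rewrite -dotv_col_mx vsubmxK.
by rewrite lerDl dotv_ge0.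
Qed.

Lemma norm2_dsubmx n k (u : 'cV[R]_(n + k)) : norm2 (dsubmx u) <= norm2 u.
Proof.
rewrite norm2_le ?norm2_ge0// norm2_sqr.
have -> : dotv u u = dotv (usubmx u) (usubmx u) + dotv (dsubmx u) (dsubmx u).
  by rewrite -dotv_col_mx vsubmxK.
by rewrite lerDr dotv_ge0.
Qed.

Lemma norm2_col_mx_le n k (a : 'cV[R]_n) (b : 'cV[R]_k) :
  norm2 (col_mx a b) <= norm2 a + norm2 b.
Proof.
have a0 := norm2_ge0 a; have b0 := norm2_ge0 b.
rewrite norm2_le ?addr_ge0// dotv_col_mx -!norm2_sqr.
by nra.
Qed.

Lemma norm2D_sqr_le n (a b : 'cV[R]_n) :
  norm2 (a + b) ^+ 2 <= 2 * norm2 a ^+ 2 + 2 * norm2 b ^+ 2.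
Proof.
have ab : norm2 (a + b) ^+ 2 <= (norm2 a + norm2 b) ^+ 2.
  by rewrite ler_sqr ?nnegrE ?addr_ge0 ?norm2_ge0// ler_norm2D.
by have := sqr_ge0 (norm2 a - norm2 b); rewrite sqrrB; rewrite sqrrD in ab; lra.
Qed.

Lemma derive1_KL_fun (gamma s : R) : 0 < s ->
  derive1 (KL_fun gamma (1 / 2)) s = gamma / 2 / Num.sqrt s.
Proof.
move=> s0; rewrite /KL_fun derive1Ml; last first.
  exact: (@ex_derive _ _ _ _ _ _ _ (is_derive1_powR _ s0)).
rewrite powR_derive1 ?in_itv/= ?s0// (_ : 1 - 1 / 2 = 2^-1); last by field.
rewrite (_ : 2^-1 - 1 = - 2^-1) ?powRN ?powR12_sqrt ?mulrA// ?ltW//.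
by field.
Qed.

Variables (N : nat) (r : 'cV[R]_N -> R) (D : set 'cV[R]_N) (c : R).
Variable h : 'cV[R]_(N + N) -> \bar R.
Hypothesis c_ge0 : 0 <= c.
Hypothesis hE : forall x y, D x ->
  h (col_mx x y) = (r x + c * norm2 (x - y) ^+ 2)%:E.
Hypothesis hNE : forall x y, ~ D x -> h (col_mx x y) = +oo%E.

(* Testing with the pairs (x', y + (x' - x)) keeps x' - y' constant, so the
   proximal term disappears and the two components of u add up. *)
Lemma frechet_subdiff_regular x y u : D x ->
  frechet_subdiff h (col_mx x y) u ->
  regular_subgradient r D x (usubmx u + dsubmx u).
Proof.
move=> Dx hu; split=> // e e0.
have [|rho rho0 zrho] := frechet_subdiff_le (hE y Dx) hu (e := e / 2).
  by rewrite divr_gt0.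
exists (rho / 2) => [|x' Dx' xx]; first by rewrite divr_gt0.
have wz : col_mx x' (y + (x' - x)) - col_mx x y = col_mx (x' - x) (x' - x).
  by rewrite opp_col_mx add_col_mx [y + _]addrC addrK.
have wzn : norm2 (col_mx (x' - x) (x' - x)) <= 2 * norm2 (x' - x).
  by rewrite (le_trans (norm2_col_mx_le _ _))//; lra.
have := zrho _ _ _ (hE (y + (x' - x)) Dx').
rewrite wz (le_lt_trans wzn)//; last by lra.
move=> /(_ isT); rewrite -{1}(vsubmxK u) dotv_col_mx dotvDl.
have -> : x' - (y + (x' - x)) = x - y by apply/colP => i; rewrite !mxE; ring.
have : e / 2 * norm2 (col_mx (x' - x) (x' - x)) <= e / 2 * (2 * norm2 (x' - x)).
  by rewrite ler_wpM2l// divr_ge0// ltW.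
by lra.
Qed.

(** Moving [y] alone, straight towards [x], leaves [r x] fixed and shrinks the proximal term at the
    rate [2 * c * norm2 (x - y) ^+ 2]; Cauchy-Schwarz does the rest. *)
Lemma frechet_subdiff_dsubmx x y u : D x ->
  frechet_subdiff h (col_mx x y) u ->
  2 * c * norm2 (x - y) <= norm2 u.
Proof.
move=> Dx hu.
have [->|xy] := eqVneq (x - y) 0; first by rewrite norm2_0 mulr0 norm2_ge0.
have xy0 : 0 < norm2 (x - y) by rewrite norm2_gt0.
pose H z := r (usubmx z) + c * norm2 (usubmx z - dsubmx z) ^+ 2.
have regH : regular_subgradient H [set z | D (usubmx z)] (col_mx x y) u.
  split=> [/=|e e0]; first by rewrite col_mxKu.
  have [rho rho0 zrho] := frechet_subdiff_le (hE y Dx) hu e0.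
  exists rho => // w Dw wz; rewrite {1}/H col_mxKu col_mxKd.
  by apply: zrho => //; rewrite -{1}(vsubmxK w) hE.
have := @regular_subgradient_curve _ _ _ _ _ _ (col_mx 0 (x - y))
  (- 2 * c * norm2 (x - y) ^+ 2) (c * norm2 (x - y) ^+ 2) 1 regH.
have hs : dotv u (col_mx 0 (x - y)) <= - 2 * c * norm2 (x - y) ^+ 2 ->
    2 * c * norm2 (x - y) <= norm2 u.
  move=> h1; rewrite -(ler_pM2r xy0).
  have := dotv_le (- u) (col_mx 0 (x - y)).
  rewrite dotvNl norm2N => h2.
  have : norm2 (col_mx (0 : 'cV[R]_N) (x - y)) <= norm2 (x - y).
    by rewrite (le_trans (norm2_col_mx_le _ _))// norm2_0 add0r.
  by have := norm2_ge0 u; nra.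
move=> curve; apply/hs/curve => //.
  by rewrite mulr_ge0// sqr_ge0.
move=> e _; exists (col_mx x (y + e *: (x - y))); split => /=.
- by rewrite col_mxKu.
- rewrite opp_col_mx add_col_mx scale_col_mx opp_col_mx add_col_mx.
  rewrite scaler0 subrr subr0 [y + _]addrC addrK subrr.
  rewrite (le_trans (norm2_col_mx_le _ _))// !norm2_0 addr0.
  by rewrite mulr_ge0 ?sqr_ge0// mulr_ge0 ?sqr_ge0.
rewrite /H !col_mxKu !col_mxKd.
have -> : x - (y + e *: (x - y)) = (1 - e) *: (x - y).
  by apply/colP => i; rewrite !mxE; ring.
rewrite norm2Z exprMn real_normK ?num_real//.
by rewrite le_eqVlt; apply/orP; left; apply/eqP; ring.
Qed.

(** On the diagonal the proximal term has its minimum 0, so it can only raise [h] nearby. This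
    provides the subgradient that the KL property requires at the base point. *)
Lemma frechet_subdiff_diag x v : regular_subgradient r D x v ->
  frechet_subdiff h (col_mx x x) (col_mx v 0).
Proof.
move=> [Dx rv]; apply: (frechet_subdiff_ge (hE x Dx)) => e e0.
have [rho rho0 xrho] := rv e e0; exists rho => // w.
rewrite -(vsubmxK w) opp_col_mx add_col_mx => wz.
have wzn := norm2_usubmx (col_mx (usubmx w - x) (dsubmx w - x)).
rewrite col_mxKu in wzn.
have [Dw|Dw] := pselect (D (usubmx w)); last by rewrite hNE// leey.
rewrite hE// lee_fin dotv_col_mx dotv0l addr0 subrr norm2_0 expr0n mulr0 addr0.
have := xrho _ Dw (le_lt_trans wzn wz).
have : 0 <= c * norm2 (usubmx w - dsubmx w) ^+ 2 by rewrite mulr_ge0// sqr_ge0.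
have : e * norm2 (usubmx w - x) <=
  e * norm2 (col_mx (usubmx w - x) (dsubmx w - x)) by rewrite ler_wpM2l// ltW.
by lra.
Qed.

Lemma KL_property_half xb K rho0 : D xb -> 0 < K -> 0 < rho0 ->
  (forall x v, norm2 (x - xb) < rho0 -> regular_subgradient r D x v ->
    r x - r xb <= K * norm2 v ^+ 2) ->
  (exists v, regular_subgradient r D xb v) ->
  KL_property h (col_mx xb xb) (1 / 2).
Proof.
move=> Dxb K0 rho00 KLr [v0 v0P].
have hxb : h (col_mx xb xb) = (r xb)%:E.
  by rewrite hE// subrr norm2_0 expr0n mulr0 addr0.
(* [4 * K] pays for adding the two components of [u], and [(4 * c)^-1] for the proximal term, since
   [c * t ^+ 2 = (2 * c * t) ^+ 2 / (4 * c)]. When [c = 0] the inverse is 0, and so is the proximal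
   term. *)
pose K1 := 4 * K + (4 * c)^-1.
have K1_gt0 : 0 < K1 by rewrite ltr_pwDl ?mulr_gt0// invr_ge0 mulr_ge0.
have frechetK z u : norm2 (z - col_mx xb xb) < rho0 ->
    frechet_subdiff h z u -> fine (h z) - r xb <= K1 * norm2 u ^+ 2.
  rewrite -(vsubmxK z); set x := usubmx z; set y := dsubmx z => zxb hu.
  have Dx : D x.
    by apply: contrapT => Dx; case: hu; rewrite hNE.
  have xxb : norm2 (x - xb) < rho0.
    apply: le_lt_trans zxb; rewrite opp_col_mx add_col_mx.
    by have := norm2_usubmx (col_mx (x - xb) (y - xb)); rewrite col_mxKu.
  have h1 := KLr _ _ xxb (frechet_subdiff_regular Dx hu).
  have h2 := frechet_subdiff_dsubmx Dx hu.
  have h3 := norm2D_sqr_le (usubmx u) (dsubmx u).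
  have uu := norm2_usubmx u; have du := norm2_dsubmx u.
  have h4 : norm2 (usubmx u + dsubmx u) ^+ 2 <= 4 * norm2 u ^+ 2.
    have : norm2 (usubmx u) ^+ 2 <= norm2 u ^+ 2.
      by rewrite ler_sqr ?nnegrE ?norm2_ge0.
    have : norm2 (dsubmx u) ^+ 2 <= norm2 u ^+ 2.
      by rewrite ler_sqr ?nnegrE ?norm2_ge0.
    by lra.
  rewrite hE//=.
  have h5 : c * norm2 (x - y) ^+ 2 <= (4 * c)^-1 * norm2 u ^+ 2.
    have [->|c0] := eqVneq c 0.
      by rewrite mul0r mulr0 invr0 mul0r.
    have cp : 0 < c by rewrite lt_neqAle eq_sym c0.
    rewrite -(@ler_pM2l _ (4 * c)) ?mulr_gt0// [leRHS]mulrA divff ?mulf_neq0//.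
    rewrite mul1r; have -> : 4 * c * (c * norm2 (x - y) ^+ 2) = (2 * c * norm2 (x - y)) ^+ 2 by ring.
    by rewrite ler_sqr ?nnegrE ?norm2_ge0// !mulr_ge0 ?norm2_ge0.
  have : K * norm2 (usubmx u + dsubmx u) ^+ 2 <= K * (4 * norm2 u ^+ 2).
    by rewrite ler_wpM2l// ltW.
  by rewrite /K1; lra.
(* The bound passes to the limit because [h (z_ k)] tends to [h z] by definition of a limiting
   subgradient, and the open ball contains [z_ k] eventually. *)
have limK z u : norm2 (z - col_mx xb xb) < rho0 ->
    limiting_subdiff h z u -> fine (h z) - r xb <= K1 * norm2 u ^+ 2.
  move=> zxb [hz [z_ [u_ [z_z hz_ hu u_u]]]].
  have c1 : (fine \o (h \o z_)) k - r xb @[k --> \oo] --> fine (h z) - r xb.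
    by apply: cvgB; [apply: fine_cvg; rewrite fineK|exact: cvg_cst].
  have c2 : K1 * norm2 (u_ k) ^+ 2 @[k --> \oo] --> K1 * norm2 u ^+ 2.
    apply: cvgMr; rewrite expr2; under eq_fun do rewrite expr2.
    suff nu : norm2 (u_ k) @[k --> \oo] --> norm2 u by exact: cvgM.
    move/cvg_norm2P/cvgrPdist_lt : u_u => u_u.
    apply/cvgrPdist_lt => e e0; apply: filterS (u_u e e0) => k.
    rewrite sub0r normrN ger0_norm ?norm2_ge0// distrC.
    exact/le_lt_trans/ler_dist_norm2.
  apply: ler_cvg_to c1 c2 _.
  have : nbhs z [set w | norm2 (w - col_mx xb xb) < rho0].
    apply/nbhs_norm2P; exists (rho0 - norm2 (z - col_mx xb xb)).
      by rewrite subr_gt0.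
    move=> w wz /=; rewrite -(subrK z w) -addrA.
    by rewrite (le_lt_trans (ler_norm2D _ _))// -ltrBrDr.
  move=> /z_z; rewrite nbhs_filterE/=; apply: filterS => k /= zk.
  exact: frechetK.
split; first by lra.
  exists (col_mx v0 0); split; first by rewrite hxb.
  exists (fun=> col_mx xb xb), (fun=> col_mx v0 0).
  by split; [exact: cvg_cst..| |exact: cvg_cst] => k; exact: frechet_subdiff_diag.
(* Chosen so that [gamma / 2 = Num.sqrt K1]: the KL inequality is then the square root of [limK]. It
   holds at every level above [r xb], hence [eta = +oo]. *)
pose gamma := 2 * Num.sqrt K1.
have sK0 : 0 < Num.sqrt K1 by rewrite sqrtr_gt0.
exists [set z | norm2 (z - col_mx xb xb) < rho0], +oo%E, gamma; split.
- by apply/nbhs_norm2P; exists rho0.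
- by rewrite ltry.
- by rewrite mulr_gt0.
move=> z zrho; rewrite hxb => hlt; rewrite addey// => hz.
have hzfin : h z \is a fin_num.
  by rewrite fin_numE; case: (h z) hlt hz => [?||].
set s := fine (h z) - fine (r xb)%:E.
have s0 : 0 < s by rewrite /s /= subr_gt0 -lte_fin fineK.
have ss0 : 0 < Num.sqrt s by rewrite sqrtr_gt0.
rewrite derive1_KL_fun//.
have g0 : 0 < gamma / 2 / Num.sqrt s by rewrite !(divr_gt0, mulr_gt0).
rewrite muleC -lee_pdivrMr// mul1e.
apply: le_ereal_inf_tmp => _ [u hu <-]; rewrite subr0 lee_fin.
have /ler_wsqrtr := limK z u zrho hu.
rewrite (sqrtrM _ (ltW K1_gt0)) sqrtr_sqr ger0_norm ?norm2_ge0// => h1.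
have -> : gamma / 2 / Num.sqrt s = Num.sqrt K1 / Num.sqrt s.
  by rewrite /gamma; field; rewrite gt_eqF.
by rewrite invf_div ler_pdivrMr// mulrC.
Qed.

End KL.

(** * The ratio of two quadratic forms *)

Section quadratic.
Variable R : realType.

Lemma qform_sub_bound n (A : 'M[R]_n) xb : A^T = A ->
  exists2 L : R, 0 < L & forall x, norm2 (x - xb) <= 1 ->
    `|qform A x - qform A xb| <= L * norm2 (x - xb).
Proof.
move=> As; have [K K0 KA] := qform_bound A.
exists (2 * norm2 (A *m xb) + K) => [|x].
  by rewrite ltr_wpDl// mulr_ge0// norm2_ge0.
set d := x - xb => d1; have -> : x = xb + d by rewrite /d addrC subrK.
have -> : qform A (xb + d) - qform A xb = 2 * dotv (A *m xb) d + qform A d.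
  by rewrite qformD//; ring.
rewrite (le_trans (ler_normD _ _))// [leRHS]mulrDl lerD//.
  by rewrite normrM gtr0_norm// -mulrA ler_wpM2l// dotv_abs_le.
rewrite (le_trans (KA d))// ler_wpM2l ?(ltW K0)// expr2.
by rewrite ler_piMr// norm2_ge0.
Qed.

Lemma qformB_scale n (A B : 'M[R]_n) a x :
  qform (A - a *: B) x = qform A x - a * qform B x.
Proof. by rewrite !qformE mulmxBl -scalemxAl !dotv_lin. Qed.

(* Q := A - rho(xb) B vanishes as a form at xb. Either T^T Q xb = 0, and then
   x^T Q x and T^T Q x depend on z through T^T Q T only, or T^T Q x stays away
   from 0 near xb. *)
Lemma rayleigh_KL n (A B : 'M[R]_n) k (T : 'M[R]_(n, k)) xb
    (rho := fun x => qform A x / qform B x) :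
  A^T = A -> B^T = B -> 0 < qform B xb ->
  exists2 K : R, 0 < K & exists2 delta : R, 0 < delta &
    forall x z, norm2 (x - xb) < delta -> x = xb + T *m z ->
    rho x - rho xb <= K * norm2 (T^T *m (A *m x - rho x *: (B *m x))) ^+ 2.
Proof.
move=> As Bs Bxb; set lam := rho xb.
pose Q := A - lam *: B.
have Qs : Q^T = Q by rewrite /Q linearB linearZ/= As Bs.
have Qxb : qform Q xb = 0.
  by rewrite /Q qformB_scale /lam /rho divfK ?subrr// gt_eqF.
have [LQ LQ0 LQP] := qform_sub_bound xb Qs.
have [LB LB0 LBP] := qform_sub_bound xb Bs.
have [K0 K00 [d0 d00 K0P]] : exists2 K0 : R, 0 < K0 & exists2 d0 : R, 0 < d0 &
    forall x z, norm2 (x - xb) < d0 -> x = xb + T *m z ->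
    qform Q x <= K0 * norm2 (T^T *m (Q *m x)) ^+ 2.
  set wb := T^T *m (Q *m xb).
  have [wb0|wb0] := eqVneq wb 0.
    have Gs : (T^T *m Q *m T)^T = T^T *m Q *m T.
      by rewrite !trmx_mul trmxK Qs mulmxA.
    have [K K0 KP] := qform_mulmx_bound Gs; exists K => //.
    exists 1 => // x z _ ->.
    rewrite qformD// Qxb add0r.
    have -> : dotv (Q *m xb) (T *m z) = 0.
      by rewrite dotvC dotv_mull -/wb wb0 dotv0r.
    rewrite !mulr0 add0r !mulmxDr -/wb wb0 add0r !mulmxA.
    rewrite (le_trans _ (KP z))// (le_trans _ (ler_norm _))//.
    by rewrite !qformE dotv_mull !mulmxA.
  have wbp : 0 < norm2 wb by rewrite norm2_gt0.
  have [K2 K20 K2P] := mulmx_norm2_bound (T^T *m Q).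
  (* Near [xb] the form is at most [LQ], while the projected residual keeps at least half of
     [norm2 wb]. *)
  exists (4 * LQ / norm2 wb ^+ 2); first by rewrite !(divr_gt0, mulr_gt0, exprn_gt0).
  exists (Num.min 1 (norm2 wb / 2 / K2)).
    by rewrite lt_min ltr01 !divr_gt0.
  move=> x z; rewrite lt_min => /andP[d1 d2] _.
  have qQ : qform Q x <= LQ.
    have := LQP x (ltW d1); rewrite Qxb subr0 => h.
    rewrite (le_trans (ler_norm _))// (le_trans h)// ler_piMr// ltW//.
  have w2 : norm2 wb / 2 <= norm2 (T^T *m (Q *m x)).
    have := ler_dist_norm2 wb (T^T *m (Q *m x)).
    have -> : wb - T^T *m (Q *m x) = T^T *m Q *m (xb - x).
      by rewrite mulmxBr /wb !mulmxA.
    move=> /(le_trans (ler_norm _)) h1.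
    have h2 := K2P (xb - x); rewrite (norm2B xb x) in h2.
    by move: d2; rewrite ltr_pdivlMr//; lra.
  apply: (le_trans qQ); rewrite mulrAC ler_pdivlMr ?exprn_gt0//.
  have : (norm2 wb / 2) ^+ 2 <= norm2 (T^T *m (Q *m x)) ^+ 2.
    by rewrite ler_sqr ?nnegrE ?norm2_ge0// divr_ge0 ?norm2_ge0.
  rewrite -(ler_pM2l LQ0); lra.
have [K3 K30 K3P] := mulmx_norm2_bound (T^T *m B).
pose P := K3 * (norm2 xb + 1).
pose beta := qform B xb / 2.
have beta0 : 0 < beta by rewrite divr_gt0.
have nxb := norm2_ge0 xb.
have P0 : 0 < P by rewrite mulr_gt0// ltr_wpDl.
(* Passing from [Q] to the residual with [rho x] adds [(rho x - lam) *: (T^T *m B *m x)]. For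
   [0 < rho x - lam <= eta] its square is at most [(rho x - lam) * eta * P ^+ 2], and [2 * K0] times
   this is [(rho x - lam) * beta / 2], half of what the left side offers. *)
pose eta := beta / (4 * K0 * P ^+ 2).
have eta0 : 0 < eta by rewrite divr_gt0// mulr_gt0 ?exprn_gt0// mulr_gt0.
exists (4 * K0 / beta); first by rewrite divr_gt0// mulr_gt0.
exists (Num.min (Num.min 1 d0) (Num.min (beta / LB) (eta * beta / LQ))).
  by rewrite !lt_min ltr01 d00/= !divr_gt0// mulr_gt0.
move=> x z; rewrite !lt_min => /andP[/andP[d1 dd0] /andP[dB dQ]] xz.
move: dB dQ; rewrite !ltr_pdivlMr// => dB dQ.
have Bx : beta <= qform B x.
  have := LBP x (ltW d1); rewrite distrC => /(le_trans (ler_norm _)).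
  by rewrite /beta in dB *; lra.
have Bx0 : 0 < qform B x by exact: lt_le_trans Bx.
have qQx : qform Q x = (rho x - lam) * qform B x.
  by rewrite /Q qformB_scale mulrBl /rho divfK// gt_eqF.
set F := T^T *m (A *m x - rho x *: (B *m x)).
have [s0|s0] := leP (rho x - lam) 0.
  by rewrite (le_trans s0)// mulr_ge0 ?sqr_ge0// divr_ge0 ?mulr_ge0// ltW.
have sle : rho x - lam <= eta.
  have := LQP x (ltW d1); rewrite Qxb subr0 => /(le_trans (ler_norm _)).
  rewrite qQx => h; rewrite -(ler_pM2r beta0).
  have : (rho x - lam) * beta <= (rho x - lam) * qform B x by rewrite ler_pM2l.
  by lra.
have wE : T^T *m (Q *m x) = F + (rho x - lam) *: (T^T *m B *m x).
  have -> : Q *m x = A *m x - rho x *: (B *m x) + (rho x - lam) *: (B *m x).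
    by rewrite /Q mulmxBl -scalemxAl scalerBl addrA subrK.
  by rewrite mulmxDr -scalemxAr mulmxA.
have TB : norm2 (T^T *m B *m x) <= P.
  rewrite (le_trans (K3P x))// ler_pM2l//.
  by have := ler_norm2D xb (x - xb); rewrite addrC subrK; lra.
have := K0P x z dd0 xz; rewrite qQx wE => h1.
have h2 := norm2D_sqr_le F ((rho x - lam) *: (T^T *m B *m x)).
have h3 : norm2 ((rho x - lam) *: (T^T *m B *m x)) ^+ 2 <=
    (rho x - lam) * eta * P ^+ 2.
  rewrite norm2Z gtr0_norm// exprMn ler_pM ?sqr_ge0//.
    by rewrite expr2 ler_pM2l.
  by rewrite ler_sqr ?nnegrE ?norm2_ge0// ltW.
have h4 : (rho x - lam) * beta <= (rho x - lam) * qform B x by rewrite ler_pM2l.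
have h5 : K0 * (eta * P ^+ 2) = beta / 4.
  by rewrite /eta; field; rewrite !gt_eqF.
rewrite mulrAC ler_pdivlMr//.
have h6 : K0 * norm2 (F + (rho x - lam) *: (T^T *m B *m x)) ^+ 2 <=
    K0 * (2 * norm2 F ^+ 2 + 2 * ((rho x - lam) * eta * P ^+ 2)).
  by rewrite ler_wpM2l ?(ltW K00)//; lra.
have h7 : K0 * (2 * norm2 F ^+ 2 + 2 * ((rho x - lam) * eta * P ^+ 2)) =
    2 * K0 * norm2 F ^+ 2 + (rho x - lam) * beta / 2.
  transitivity (2 * K0 * norm2 F ^+ 2
                + 2 * (rho x - lam) * (K0 * (eta * P ^+ 2))); first by ring.
  by rewrite h5; lra.
by lra.
Qed.

End quadratic.

Section rayleigh.
Variable R : realType.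

(** The test curve is [x - e *: F] normalized, [F] being the residual. As [F] is orthogonal to [x],
    normalizing moves the point by order [e ^+ 2] only, and it does not change the quotient. The
    rate of decrease is [2 * norm2 F ^+ 2 / qform B x]; half of [2 * norm2 F ^+ 2 / K] is kept,
    since [qform B w] is only bounded by [2 * K]. *)
Lemma rayleigh_regular_subgradient n (A B : 'M[R]_n) (K : R) :
  A^T = A -> sym_posdef B -> 0 < K ->
  (forall x, `|qform B x| <= K * norm2 x ^+ 2) ->
  forall x v,
  let rho := fun x => qform A x / qform B x in
  regular_subgradient rho (@sphere R n) x v ->
  norm2 (A *m x - rho x *: (B *m x)) <= K * norm2 v.
Proof.
move=> As [Bs Bpos] K0 KB x v rho rv.
have [x1 _] := rv; rewrite /sphere/= in x1.
pose Q := A - rho x *: B.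
set F := A *m x - _.
have QF : Q *m x = F by rewrite /Q mulmxBl -scalemxAl.
clearbody F.
have [->|F0] := eqVneq F 0.
  by rewrite norm2_0 mulr_ge0 ?norm2_ge0// ltW.
have Fp : 0 < norm2 F by rewrite norm2_gt0.
have x0 : x != 0 by rewrite -norm2_gt0 x1.
have b0 := Bpos _ x0.
have Qs : Q^T = Q by rewrite /Q linearB linearZ/= As Bs.
have Qx0 : qform Q x = 0.
  by rewrite /Q qformB_scale /rho divfK ?subrr// gt_eqF.
have xF : dotv x F = 0 by rewrite -QF -qformE.
have [L L0 LP] := qform_sub_bound x Bs.
have NF := norm2N F.
(* The bound 1 on [e * norm2 F] gives [norm2 w ^+ 2 <= 2]; the other keeps [qform B w] above half of
   [qform B x]. *)
pose e0 := Num.min 1 (qform B x / 2 / L) / norm2 F.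
have e00 : 0 < e0 by rewrite divr_gt0// lt_min ltr01 !divr_gt0.
(* The first summand is the cost of normalizing, the second that of the [e ^+ 2] term in
   [qform Q w]. *)
pose C := norm2 F ^+ 2 + `|qform Q F| / (qform B x / 2).
have C0 : 0 <= C by rewrite addr_ge0 ?sqr_ge0// !divr_ge0// ltW.
have := @regular_subgradient_curve _ _ _ _ _ _ (- F)
  (- (norm2 F ^+ 2 / K)) C e0 rv C0 e00.
have concl : dotv v (- F) <= - (norm2 F ^+ 2 / K) -> norm2 F <= K * norm2 v.
  rewrite dotvNr lerN2 ler_pdivrMr// => h; rewrite -(ler_pM2r Fp) -expr2.
  rewrite (le_trans h)// mulrC -mulrA ler_pM2l//; exact: dotv_le.
move=> curve; apply/concl/curve => e /andP[ep].
rewrite ler_pdivlMr// le_min => /andP[eF1 eFL].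
set w := x + e *: - F.
have w2 : dotv w w = 1 + e ^+ 2 * norm2 F ^+ 2.
  rewrite /w !dotv_lin (dotvC F x) xF -!norm2_sqr x1.
  by rewrite expr1n; ring.
have nw : norm2 w ^+ 2 = 1 + e ^+ 2 * norm2 F ^+ 2 by rewrite norm2_sqr.
have eF0 : 0 <= e ^+ 2 * norm2 F ^+ 2 by rewrite mulr_ge0 ?sqr_ge0.
have w1 : 1 <= norm2 w.
  by rewrite -(@ler_sqr _ 1) ?nnegrE ?norm2_ge0// nw expr1n; lra.
have w0 : 0 < norm2 w by lra.
have wx : norm2 (w - x) = e * norm2 F.
  by rewrite /w addrC addKr norm2Z norm2N gtr0_norm.
have eF2 : e ^+ 2 * norm2 F ^+ 2 <= 1.
  by rewrite -exprMn expr_le1// mulr_ge0 ?norm2_ge0// ltW.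
have bw2 : qform B w <= 2 * K.
  rewrite (le_trans (ler_norm _))// (le_trans (KB w))// mulrC ler_pM2r//.
  by rewrite nw; lra.
have bw1 : qform B x / 2 <= qform B w.
  have := LP w; rewrite wx => /(_ eF1); rewrite distrC => /(le_trans (ler_norm _)).
  by move: eFL; rewrite ler_pdivlMr//; lra.
have bw0 : 0 < qform B w by lra.
exists ((norm2 w)^-1 *: w); split.
- by rewrite /sphere/= norm2Z gtr0_norm ?invr_gt0// mulVf// gt_eqF.
- have -> : (norm2 w)^-1 *: w - x - e *: - F = ((norm2 w)^-1 - 1) *: w.
    by rewrite scalerBl scale1r -addrA -opprD.
  rewrite norm2Z -{2}(gtr0_norm w0) -normrM mulrBl mulVf ?gt_eqF// mul1r.
  rewrite distrC ger0_norm ?subr_ge0//.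
  have : norm2 w - 1 <= e ^+ 2 * norm2 F ^+ 2 by nra.
  have : 0 <= e ^+ 2 * (`|qform Q F| / (qform B x / 2)).
    by rewrite mulr_ge0 ?sqr_ge0// divr_ge0// ltW// divr_gt0.
  by rewrite /C; lra.
rewrite {1}/rho !qformZ -mulf_div divff ?mul1r; last first.
  by rewrite expf_neq0// invr_eq0 gt_eqF.
have -> : qform A w / qform B w = rho x + qform Q w / qform B w.
  by rewrite /Q qformB_scale; field; rewrite gt_eqF.
rewrite -addrA lerD2l.
have -> : qform Q w = - (2 * e * norm2 F ^+ 2) + e ^+ 2 * qform Q F.
  rewrite /w qformD// Qx0 QF qformZ !dotv_lin -norm2_sqr.
  by rewrite -[- F]scaleN1r qformZ; ring.
rewrite mulrDl lerD//.
  rewrite mulNr mulrN lerN2 ler_pdivlMr//.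
  have -> : e * (norm2 F ^+ 2 / K) * qform B w
    = e * norm2 F ^+ 2 / K * qform B w by ring.
  rewrite mulrAC ler_pdivrMr//.
  have : e * norm2 F ^+ 2 * qform B w <= e * norm2 F ^+ 2 * (2 * K).
    by rewrite ler_wpM2l// mulr_ge0 ?sqr_ge0// ltW.
  by lra.
rewrite -mulrA [leRHS]mulrC; apply: ler_wpM2l; first exact: sqr_ge0.
rewrite (le_trans _ (_ : `|qform Q F| / qform B w <= _))//.
  by rewrite ler_wpM2r ?ler_norm// invr_ge0 ltW.
rewrite -[leLHS]add0r lerD ?sqr_ge0// ler_wpM2l// lef_pV2 ?posrE//.
by rewrite divr_gt0.
Qed.

(** The residual is orthogonal to [x], hence already tangent to the sphere, so [rayleigh_KL] is used
    in the whole space, with [T] the identity. *)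
Lemma quadratic_KL n (A B : 'M[R]_n) xb :
  A^T = A -> sym_posdef B -> sphere xb ->
  let rho := fun x => qform A x / qform B x in
  exists2 K, 0 < K & exists2 rho0, 0 < rho0 & forall x v,
    norm2 (x - xb) < rho0 -> regular_subgradient rho (@sphere R n) x v ->
    rho x - rho xb <= K * norm2 v ^+ 2.
Proof.
move=> As Bpd xb1 rho; have [Bs Bpos] := Bpd.
have xb0 : xb != 0 by rewrite -norm2_gt0 xb1.
have [KB KB0 KBP] := qform_bound B.
have [K K0 [d d0 KP]] := rayleigh_KL 1%:M As Bs (Bpos _ xb0).
exists (K * KB ^+ 2); first by rewrite mulr_gt0 ?exprn_gt0.
exists d => // x v xd rv.
have := KP x (x - xb) xd; rewrite mul1mx addrC subrK trmx1 mul1mx => /(_ erefl).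
move=> /le_trans; apply; rewrite -mulrA ler_pM2l// -exprMn.
rewrite ler_sqr ?nnegrE ?norm2_ge0//; last by rewrite mulr_ge0 ?norm2_ge0// ltW.
exact: rayleigh_regular_subgradient rv.
Qed.

End rayleigh.

(** * The ratio of the l1 and l2 norms on a polyhedron *)

Section kernel.
Variable R : realType.

(** [kermx] describes the row kernel; the transpositions give a matrix whose columns span the kernel
    of [E]. *)
Definition null_mx m n (E : 'M[R]_(m, n)) : 'M[R]_n := (kermx E^T)^T.

Lemma mul_null_mx m n (E : 'M[R]_(m, n)) : E *m null_mx E = 0.
Proof. by apply: trmx_inj; rewrite trmx_mul trmxK mulmx_ker trmx0. Qed.

Lemma null_mxP m n (E : 'M[R]_(m, n)) (t : 'cV[R]_n) :
  E *m t = 0 -> exists z, t = null_mx E *m z.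
Proof.
move=> Et; have /sub_kermxP/submxP[z tz] : t^T *m E^T = 0.
  by rewrite -trmx_mul Et trmx0.
by exists z^T; rewrite -trmx_mul -tz trmxK.
Qed.

End kernel.

Section sparse.
Variable R : realType.
Variables (N M0 P : nat).
Variables (A : 'M[R]_(M0, N)) (b : 'cV[R]_M0) (C : 'M[R]_(P, N)) (d : 'cV[R]_P).

Definition polyhedron : set 'cV[R]_N :=
  [set x | (forall i, (A *m x) i 0 <= b i 0) /\ C *m x = d].

(* Positive coordinates, negative coordinates, active inequality constraints. *)
Definition pattern := ({set 'I_N} * {set 'I_N} * {set 'I_M0})%type.

Definition pattern_of (x : 'cV[R]_N) : pattern :=
  ([set i | 0 < x i 0]%SET, [set i | x i 0 < 0]%SET,
   [set i | (A *m x) i 0 == b i 0]%SET).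

Definition sign_cV (p : pattern) : 'cV[R]_N :=
  \col_i ((i \in p.1.1)%:R - (i \in p.1.2)%:R).

(* Its kernel is the set of directions along which, near a point with pattern p,
   the polyhedron is flat and the l1 norm is linear. *)
Definition face_mx (p : pattern) : 'M[R]_(P + N + M0, N) :=
  let zero_rows : 'M[R]_N :=
    diag_mx (\row_(i < N) ((i \notin p.1.1) && (i \notin p.1.2))%:R) in
  let active_rows : 'M[R]_M0 := diag_mx (\row_(i < M0) (i \in p.2)%:R) in
  col_mx (col_mx C zero_rows) (active_rows *m A).

Lemma face_mxP (p : pattern) (t : 'cV[R]_N) : face_mx p *m t = 0 <->
  [/\ C *m t = 0, forall i, i \notin p.1.1 -> i \notin p.1.2 -> t i 0 = 0 &
      forall i, i \in p.2 -> (A *m t) i 0 = 0].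
Proof.
rewrite /face_mx !mul_col_mx -mulmxA !mul_diag_mx; split.
  move/eqP; rewrite !col_mx_eq0 => /andP[/andP[/eqP Ct /eqP t0] /eqP At].
  split=> // [i ip iq|i ip].
    by have /colP/(_ i) := t0; rewrite !mxE ip iq mul1r.
  by have /colP/(_ i) := At; rewrite !mxE ip mul1r.
move=> [Ct t0 At]; apply/eqP; rewrite !col_mx_eq0 Ct eqxx/=.
apply/andP; split; apply/eqP/colP => i; rewrite !mxE.
  case: (boolP (i \in p.1.1)) => ip; rewrite ?mul0r//=.
  by case: (boolP (i \in p.1.2)) => iq; rewrite ?mul0r//= mul1r t0.
case: (boolP (i \in p.2)) => ip; rewrite ?mul0r// mul1r.
by have := At i ip; rewrite mxE.
Qed.

Lemma dotv_near_lt n (a x : 'cV[R]_n) (c : R) : dotv a x < c ->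
  \forall y \near nbhs x, dotv a y < c.
Proof.
move=> axc; have a0 := norm2_ge0 a; have a1 : 0 < norm2 a + 1 by lra.
apply/nbhs_norm2P; exists ((c - dotv a x) / (norm2 a + 1)).
  by rewrite divr_gt0// subr_gt0.
move=> y; rewrite ltr_pdivlMr// => yx.
have := dotv_le a (y - x); rewrite dotvDr dotvNr => h.
by have := norm2_ge0 (y - x); nra.
Qed.

Lemma mulmx_coord_dotv m n (B : 'M[R]_(m, n)) x i :
  (B *m x) i 0 = dotv (row i B)^T x.
Proof. by rewrite /dotv trmxK -row_mul [RHS]mxE. Qed.

Lemma nbhs_forall n (I : finType) (x : 'cV[R]_n) (f : I -> set 'cV[R]_n) :
  (forall i, nbhs x (f i)) -> nbhs x [set y | forall i, f i y].
Proof. by move=> fx; exact: (filter_forall (nbhs_filter x) fx). Qed.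

(** Nonzero signs and inactive constraints are finitely many strict linear inequalities, hence open
    conditions. *)
Lemma pattern_near x : exists2 e : R, 0 < e & forall y, norm2 (y - x) < e ->
  [/\ forall i, 0 < x i 0 -> 0 < y i 0, forall i, x i 0 < 0 -> y i 0 < 0 &
      forall i, (A *m x) i 0 < b i 0 -> (A *m y) i 0 < b i 0].
Proof.
apply/nbhs_norm2P.
have h1 : nbhs x [set y : 'cV[R]_N | forall i, 0 < x i 0 -> 0 < y i 0].
  apply: (@nbhs_forall _ _ _ (fun i (y : 'cV[R]_N) =>
    0 < x i 0 -> 0 < y i 0)) => i; have [xi|xi] := ltP 0 (x i 0); last first.
    exact: filterE.
  have : dotv (- delta_mx i 0) x < 0 by rewrite dotvNl -coord_dotv oppr_lt0.
  move=> /dotv_near_lt; apply: filterS => y.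
  by rewrite dotvNl -coord_dotv oppr_lt0.
have h2 : nbhs x [set y : 'cV[R]_N | forall i, x i 0 < 0 -> y i 0 < 0].
  apply: (@nbhs_forall _ _ _ (fun i (y : 'cV[R]_N) =>
    x i 0 < 0 -> y i 0 < 0)) => i; have [xi|xi] := ltP (x i 0) 0; last first.
    exact: filterE.
  by rewrite coord_dotv in xi; move/dotv_near_lt : xi; apply: filterS => y; rewrite -coord_dotv.
have h3 : nbhs x [set y : 'cV[R]_N |
    forall i, (A *m x) i 0 < b i 0 -> (A *m y) i 0 < b i 0].
  apply: (@nbhs_forall _ _ _ (fun i (y : 'cV[R]_N) =>
    (A *m x) i 0 < b i 0 -> (A *m y) i 0 < b i 0)) => i; have [xi|xi] := ltP ((A *m x) i 0) (b i 0); last first.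
    exact: filterE.
  by rewrite mulmx_coord_dotv in xi; move/dotv_near_lt : xi; apply: filterS => y; rewrite -mulmx_coord_dotv.
by apply: filterS3 h1 h2 h3 => y; split.
Qed.

Lemma norm1_sign x : dotv (sign_cV (pattern_of x)) x = norm1 x.
Proof.
rewrite dotvE; apply: eq_bigr => i _; rewrite !mxE/= !inE.
by case: ltrgt0P => xi; rewrite ?subr0 ?sub0r ?mul1r ?mulN1r// xi ?mulr0 ?normr0.
Qed.

(** Moving from [xb] to a nearby [x], coordinates can only cease to be zero and constraints cease to
    be active. What vanishes or is active at [x] was so at [xb]; therefore everything is expressed
    through the pattern of [x], not that of [xb]. *)
Lemma pattern_near_face xb : polyhedron xb ->
  exists2 e : R, 0 < e & forall x, polyhedron x -> norm2 (x - xb) < e ->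
    dotv (sign_cV (pattern_of x)) xb = norm1 xb /\
    face_mx (pattern_of x) *m (x - xb) = 0.
Proof.
move=> [Axb Cxb]; have [e e0 xbP] := pattern_near xb; exists e => // x [Ax Cx] xe.
have [pos neg act] := xbP x xe; split.
  rewrite dotvE; apply: eq_bigr => i _; rewrite !mxE/= !inE.
  have [/pos xi|/neg xi|->] := ltrgt0P (xb i 0).
  - by rewrite xi ltNge (ltW xi)/= subr0 mul1r.
  - by rewrite xi ltNge (ltW xi)/= sub0r mulN1r.
  - by rewrite mulr0.
apply/face_mxP; split.
- by rewrite mulmxBr Cx Cxb subrr.
- move=> i; rewrite /= !inE -!leNgt => xi1 xi2.
  have xi : x i 0 = 0 by apply/eqP; rewrite eq_le xi1 xi2.
  rewrite !mxE xi; have [/pos|/neg|->] := ltrgt0P (xb i 0); last by rewrite subrr.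
    by rewrite xi ltxx.
  by rewrite xi ltxx.
move=> i; rewrite /= !inE => /eqP xi.
rewrite mulmxBr mxE xi [X in _ + X]mxE; apply/eqP; rewrite subr_eq0 eq_le Axb andbT.
by rewrite leNgt; apply/negP => /act; rewrite xi ltxx.
Qed.

(** Zero coordinates and active constraints do not change along [t], and a short step preserves the
    strict inequalities. The test curve is thus a segment on which the l1 norm is exactly linear. *)
Lemma pattern_direction x t : polyhedron x -> face_mx (pattern_of x) *m t = 0 ->
  exists2 e0 : R, 0 < e0 & forall e, 0 < e <= e0 -> polyhedron (x + e *: t) /\
    norm1 (x + e *: t) = norm1 x + e * dotv (sign_cV (pattern_of x)) t.
Proof.
move=> [Ax Cx] /face_mxP[Ct t0 At].
have [e1 e10 xP] := pattern_near x.
have tn := norm2_ge0 t; have tp : 0 < norm2 t + 1 by lra.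
exists (e1 / (norm2 t + 1)); first by rewrite divr_gt0.
move=> e /andP[e0]; rewrite ler_pdivlMr// => ele.
have [|pos neg act] := xP (x + e *: t).
  by rewrite addrC addKr norm2Z gtr0_norm//; nra.
split.
  split=> [i|]; last by rewrite mulmxDr -scalemxAr Ct scaler0 addr0.
  have := Ax i; rewrite le_eqVlt => /orP[xi|/act/ltW//].
  have ti : (A *m t) i 0 = 0 by apply: At; rewrite /= inE.
  by rewrite mulmxDr -scalemxAr mxE [X in _ + X]mxE ti mulr0 addr0 (eqP xi).
rewrite -(norm1_sign x) !dotvE mulr_sumr -big_split/=; apply: eq_bigr => i _.
rewrite !mxE/= !inE.
have /= := t0 i; rewrite !inE.
have [/[dup] xi /pos|/[dup] xi /neg|xi] := ltrgt0P (x i 0).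
- rewrite !mxE => yi _; rewrite gtr0_norm//=; ring.
- rewrite !mxE => yi _; rewrite ltr0_norm//=; ring.
- by move=> /(_ isT isT) ->; rewrite xi !mulr0 addr0 normr0.
Qed.

End sparse.

Section sparse_KL.
Variable R : realType.
Variables (N M0 P : nat).
Variables (A : 'M[R]_(M0, N)) (b : 'cV[R]_M0) (C : 'M[R]_(P, N)) (d : 'cV[R]_P).

Let S := polyhedron A b C d.
Definition l1_l2_ratio (x : 'cV[R]_N) : R := norm1 x / norm2 x.

Hypothesis S0 : ~ S 0.

(** Along a face direction [t] the ratio has derivative [dotv w t / (norm1 x * norm2 x)], where [w]
    is the residual of the squared ratio as a Rayleigh quotient. The choice [t = - (T *m Tw)] makes
    [dotv w t] equal to [- norm2 Tw ^+ 2]. *)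
Lemma l1_l2_ratio_regular_subgradient x v
    (T := null_mx (face_mx A C (pattern_of A b x)))
    (s := sign_cV R (pattern_of A b x)) :
  regular_subgradient l1_l2_ratio S x v ->
  norm2 (T^T *m (dotv s x *: s - l1_l2_ratio x ^+ 2 *: x)) <=
    2 * norm1 x * norm2 x * norm2 (T^T *m v).
Proof.
move=> rv; have [Sx _] := rv.
have x0 : x != 0 by apply: contra_notN S0 => /eqP <-.
have xp : 0 < norm2 x by rewrite norm2_gt0.
have x1 : 0 < norm1 x by rewrite (lt_le_trans xp)// norm2_le_norm1.
set w := _ - _.
set Tw := T^T *m w; pose t := - (T *m Tw).
have Et : face_mx A C (pattern_of A b x) *m t = 0.
  by rewrite /t mulmxN mulmxA mul_null_mx mul0mx oppr0.
have [e0 e00 dir] := pattern_direction Sx Et.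
have wt : dotv w t = - norm2 Tw ^+ 2.
  by rewrite dotvNr norm2_sqr /Tw dotvC dotv_mull.
have wE : dotv w t = norm1 x * dotv s t - l1_l2_ratio x ^+ 2 * dotv x t.
  by rewrite /w norm1_sign dotvDl dotvNl !dotvZl.
have vt : dotv v t = - dotv (T^T *m v) Tw.
  by rewrite dotvNr dotv_mull trmxK.
have [Tw0|Tw0] := eqVneq Tw 0.
  by rewrite Tw0 norm2_0 !mulr_ge0 ?norm2_ge0// ltW.
have Twp : 0 < norm2 Tw by rewrite norm2_gt0.
clearbody w t Tw.
(* A step this short at most doubles [norm2], which accounts for the factor 2 in the bound. *)
pose e1 := Num.min e0 (norm2 x / (norm2 t + 1)).
have tn := norm2_ge0 t; have tp : 0 < norm2 t + 1 by lra.
have e10 : 0 < e1 by rewrite lt_min e00 divr_gt0.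
suff : dotv v t <= - (norm2 Tw ^+ 2 / (2 * norm1 x * norm2 x)).
  have := dotv_le (T^T *m v) Tw.
  rewrite vt lerN2 ler_pdivrMr ?mulr_gt0// => h1 h2.
  rewrite -(ler_pM2r Twp) -expr2 (le_trans h2)// [leLHS]mulrC -[leRHS]mulrA ler_pM2l//.
  by rewrite !mulr_gt0.
apply: (regular_subgradient_curve rv (lexx 0) e10) => e /andP[ep].
rewrite le_min ler_pdivlMr// => /andP[ee0 ee1].
have [|Sy y1] := dir e; first by rewrite ep.
exists (x + e *: t); split => //.
  by rewrite [x + _]addrC addrK subrr norm2_0 mul0r.
rewrite mul0r addr0.
have y0 : x + e *: t != 0 by apply: contra_notN S0 => /eqP <-.
have yp : 0 < norm2 (x + e *: t) by rewrite norm2_gt0.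
have y2 : norm2 (x + e *: t) <= 2 * norm2 x.
  rewrite (le_trans (ler_norm2D _ _))// norm2Z gtr0_norm//; nra.
have yx : norm2 x ^+ 2 + e * dotv x t <= norm2 (x + e *: t) * norm2 x.
  by rewrite [leRHS]mulrC norm2_sqr -dotvZr -dotvDr dotv_le.
rewrite -lerBlDl /l1_l2_ratio y1.
have -> : (norm1 x + e * dotv s t) / norm2 (x + e *: t) - norm1 x / norm2 x =
    ((norm1 x + e * dotv s t) * norm2 x - norm1 x * norm2 (x + e *: t))
    / (norm2 x * norm2 (x + e *: t)).
  by field; rewrite !gt_eqF.
have h : norm1 x * dotv s t * norm2 x ^+ 2 - norm1 x ^+ 2 * dotv x t =
    - (norm2 Tw ^+ 2 * norm2 x ^+ 2).
  rewrite -[RHS]mulNr -wt wE /l1_l2_ratio; field; rewrite gt_eqF//.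
rewrite ler_pdivrMr ?mulr_gt0//.
rewrite -(@ler_pM2r _ (norm1 x * norm2 x)) ?mulr_gt0//.
have -> : e * - (norm2 Tw ^+ 2 / (2 * norm1 x * norm2 x)) *
  (norm2 x * norm2 (x + e *: t)) * (norm1 x * norm2 x) =
  - (e * norm2 Tw ^+ 2 * norm2 x / 2 * norm2 (x + e *: t)).
  by field; rewrite !gt_eqF.
have h2 : e * norm2 Tw ^+ 2 * norm2 x / 2 * norm2 (x + e *: t) <=
    e * norm2 Tw ^+ 2 * norm2 x / 2 * (2 * norm2 x).
  by rewrite ler_wpM2l// divr_ge0// !mulr_ge0 ?sqr_ge0// ltW.
have h3 : norm1 x ^+ 2 * (norm2 x ^+ 2 + e * dotv x t) <=
    norm1 x ^+ 2 * (norm2 (x + e *: t) * norm2 x).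
  by rewrite ler_wpM2l ?sqr_ge0.
have h4 : e * (norm1 x * dotv s t * norm2 x ^+ 2 - norm1 x ^+ 2 * dotv x t) =
    - (e * (norm2 Tw ^+ 2 * norm2 x ^+ 2)) by rewrite h mulrN.
by lra.
Qed.

Lemma l1_l2_ratio_ge1 (x : 'cV[R]_N) : x != 0 -> 1 <= l1_l2_ratio x.
Proof.
by move=> x0; rewrite ler_pdivlMr ?norm2_gt0// mul1r norm2_le_norm1.
Qed.

Lemma qform_rank1 (s x : 'cV[R]_N) : qform (s *m s^T) x = dotv s x ^+ 2.
Proof.
rewrite qformE -mulmxA [s^T *m x]mx11_scalar -/(dotv s x) mul_mx_scalar.
by rewrite dotvZr dotvC expr2.
Qed.

Lemma qform1 (x : 'cV[R]_N) : qform 1%:M x = norm2 x ^+ 2.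
Proof. by rewrite qformE mul1mx norm2_sqr. Qed.

Lemma l1_l2_ratio_KL xb : S xb ->
  exists2 K, 0 < K & exists2 rho0, 0 < rho0 & forall x v,
    norm2 (x - xb) < rho0 -> regular_subgradient l1_l2_ratio S x v ->
    l1_l2_ratio x - l1_l2_ratio xb <= K * norm2 v ^+ 2.
Proof.
move=> Sxb.
have xb0 : xb != 0 by apply: contra_notN S0 => /eqP <-.
have xbp : 0 < qform 1%:M xb by rewrite qform1 exprn_gt0// norm2_gt0.
pose T (p : pattern N M0) := null_mx (face_mx A C p).
pose s (p : pattern N M0) := sign_cV R p.
have rank1_sym p : (s p *m (s p)^T)^T = s p *m (s p)^T.
  by rewrite trmx_mul trmxK.
(* The pattern of [x] is not known in advance, so constants and a neighborhood are taken for each of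
   the finitely many [p]. The quotient formed with [s p] is identified with the ratio once [p] is
   the pattern of [x]. *)
have /choice[K KP] : forall p, exists K : R * R, [/\ 0 < K.1, 0 < K.2 &
    forall v, norm2 ((T p)^T *m v) <= K.2 * norm2 v] /\
    nbhs xb [set x | forall z, x = xb + T p *m z ->
      (dotv (s p) x / norm2 x) ^+ 2 - (dotv (s p) xb / norm2 xb) ^+ 2 <=
      K.1 * norm2 ((T p)^T *m
        (dotv (s p) x *: s p - (dotv (s p) x / norm2 x) ^+ 2 *: x)) ^+ 2].
  move=> p; have [K1 K10 [e e0 K1P]] :=
    rayleigh_KL (T p) (rank1_sym p) (trmx1 _ _) xbp.
  have [K2 K20 K2P] := mulmx_norm2_bound (T p)^T.
  exists (K1, K2); split=> [//|]; apply/nbhs_norm2P; exists e => // x xe z xz.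
  have := K1P x z xe xz; rewrite !qform_rank1 !qform1 -!expr_div_n mul1mx.
  rewrite -[in X in _ <= X -> _]mulmxA [(s p)^T *m x]mx11_scalar -/(dotv (s p) x).
  by rewrite mul_mx_scalar.
have [e1 e10 faceP] := pattern_near_face Sxb.
have /nbhs_norm2P[e2 e20 nearP] :=
  nbhs_forall (fun p => proj2 (KP p)).
(* Bounds [2 * norm1 x * norm2 x] on the unit ball around [xb]. *)
pose B := 2 * (N%:R * (norm2 xb + 1)) * (norm2 xb + 1).
have xbn := norm2_ge0 xb.
have B0 : 0 <= B by rewrite !mulr_ge0// addr_ge0.
pose K0 := 1 + \sum_p (K p).1 * (B * (K p).2) ^+ 2.
have Kp p : (K p).1 * (B * (K p).2) ^+ 2 <= K0.
  rewrite /K0 (bigD1 p)//= addrCA lerDl addr_ge0// sumr_ge0// => q _.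
  by have [[/ltW h _ _] _] := KP q; rewrite mulr_ge0// sqr_ge0.
have K00 : 0 < K0.
  rewrite ltr_pwDl// sumr_ge0// => q _.
  by have [[/ltW h _ _] _] := KP q; rewrite mulr_ge0// sqr_ge0.
exists K0 => //; exists (Num.min 1 (Num.min e1 e2)).
  by rewrite !lt_min ltr01 e10.
move=> x v; rewrite !lt_min => /and3P[xb1 xbe1 xbe2] rv.
have [Sx _] := rv; set p := pattern_of A b x.
have x0 : x != 0 by apply: contra_notN S0 => /eqP <-.
have [sxb /null_mxP[z zE]] := faceP x Sx xbe1.
have xz : x = xb + T p *m z by rewrite -zE addrC subrK.
have [[Kp1 Kp2 Kp3] _] := KP p.
have := nearP x xbe2 p z xz.
rewrite /s norm1_sign sxb => h1.
have h2 := l1_l2_ratio_regular_subgradient rv; rewrite norm1_sign in h2.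
have nx : norm2 x <= norm2 xb + 1.
  by have := ler_norm2D xb (x - xb); rewrite addrC subrK; lra.
have h3 : 2 * norm1 x * norm2 x * norm2 ((T p)^T *m v) <=
    B * (K p).2 * norm2 v.
  have n1 : norm1 x <= N%:R * (norm2 xb + 1).
    by rewrite (le_trans (norm1_le_norm2 _))// ler_wpM2l.
  have n1_ge0 : 0 <= norm1 x by apply: sumr_ge0.
  rewrite -[leRHS]mulrA ler_pM ?mulr_ge0 ?norm2_ge0//.
  by rewrite /B ler_pM ?mulr_ge0 ?norm2_ge0// ler_wpM2l.
have h4 : l1_l2_ratio x ^+ 2 - l1_l2_ratio xb ^+ 2 <= K0 * norm2 v ^+ 2.
  have : norm2 ((T p)^T *m (norm1 x *: s p - l1_l2_ratio x ^+ 2 *: x)) ^+ 2 <=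
      (B * (K p).2) ^+ 2 * norm2 v ^+ 2.
    rewrite -exprMn ler_sqr ?nnegrE ?norm2_ge0//; first exact: le_trans h2 h3.
    by rewrite mulr_ge0 ?norm2_ge0// mulr_ge0// ltW.
  move=> /(ler_wpM2l (ltW Kp1)) h5; apply: le_trans h1 (le_trans h5 _).
  by rewrite mulrA ler_wpM2r ?sqr_ge0.
(* Back from squares: both ratios are at least 1, so a positive difference is at most the difference
   of the squares. *)
have r1 := l1_l2_ratio_ge1 x0; have r2 := l1_l2_ratio_ge1 xb0.
have [r3|r3] := leP (l1_l2_ratio x) (l1_l2_ratio xb).
  by rewrite (@le_trans _ _ 0)// ?subr_le0// mulr_ge0 ?sqr_ge0// ltW.
apply: le_trans h4; rewrite subr_sqr; nra.
Qed.

End sparse_KL.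

(** * Smoothness and compactness *)

Section tangent.
Variable R : realType.
Implicit Types N : nat.

(** The lower half is the subgradient inequality of a convex function, the upper half the descent
    lemma; together they force [p] to be the gradient. *)
Definition tangent_bounds N (f : 'cV[R]_N -> R) (x p : 'cV[R]_N) (K : R) :=
  forall y, 0 <= f y - f x - dotv p (y - x) <= K * norm2 (y - x) ^+ 2.

Lemma tangent_bounds_grad N (f : 'cV[R]_N -> R) x p K :
  tangent_bounds f x p K -> grad f x = p.
Proof.
move=> fK; apply/colP => i; rewrite mxE coord_dotv.
set v : 'cV[R]_N := delta_mx i 0; rewrite dotvC /derive.
apply: cvg_lim => //; apply/cvgrPdist_lt => e e0.
have v0 := norm2_ge0 v.
have K1 : 0 < `|K| * norm2 v ^+ 2 + 1.
  by rewrite ltr_wpDl// mulr_ge0 ?sqr_ge0.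
near=> h.
have h0 : h != 0 by near: h; exact: nbhs_dnbhs_neq.
have he : `|h| * (`|K| * norm2 v ^+ 2 + 1) < e.
  rewrite -ltr_pdivlMr//; near: h.
  by apply: dnbhs0_lt; rewrite divr_gt0.
have hp : 0 < `|h| by rewrite normr_gt0.
have := fK (h *: v + x); rewrite addrK dotvZr norm2Z => /andP[f1 f2].
rewrite /= [_ *: _]mulrC -normrN opprB -(ltr_pM2r hp) -normrM mulrBl divfK//.
have -> : f (h *: v + x) - f x - dotv p v * h
  = f (h *: v + x) - f x - h * dotv p v by rewrite [h * _]mulrC.
rewrite ger0_norm//; apply: (le_lt_trans f2).
rewrite exprMn mulrCA.
have : K * norm2 v ^+ 2 <= `|K| * norm2 v ^+ 2.
  by rewrite ler_wpM2r ?sqr_ge0// ler_norm.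
by rewrite expr2 -mulrA [ltRHS]mulrC ltr_pM2l//; nra.
Unshelve. all: by end_near. Qed.

(** With [r = a x / b x], the increment of the quotient is [(a y - r * b y) / b y]. As [r] is
    nonnegative, the numerator is minorized with slope [p - r *: q]; replacing [b y] by [b x] costs
    a second-order amount, [b] being Lipschitz near [x]. *)
Lemma regular_subgradient_div N (D : set 'cV[R]_N) (a b : 'cV[R]_N -> R)
    x p q Ka Kb :
  D x -> (forall y, D y -> 0 < b y) -> 0 <= a x -> 0 <= Ka -> 0 <= Kb ->
  (forall y, D y -> a x + dotv p (y - x) - Ka * norm2 (y - x) ^+ 2 <= a y) ->
  tangent_bounds b x q Kb ->
  regular_subgradient (fun y => a y / b y) D x
    ((b x)^-1 *: (p - (a x / b x) *: q)).
Proof.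
move=> Dx Db ax Ka0 Kb0 aK bK; split=> // e e0.
have bx := Db x Dx; set r := a x / b x.
have r0 : 0 <= r by rewrite divr_ge0// ltW.
set w := p - r *: q.
pose L := norm2 q + Kb; pose K := Ka + r * Kb.
have qn := norm2_ge0 q; have wn := norm2_ge0 w.
have L0 : 0 <= L by rewrite addr_ge0.
have K0 : 0 <= K by rewrite addr_ge0// mulr_ge0.
pose M := (norm2 w * L / b x + K) / (b x / 2).
have wLb : 0 <= norm2 w * L / b x by rewrite divr_ge0 ?mulr_ge0// ltW.
have bx2 : 0 < b x / 2 by rewrite divr_gt0.
have M0 : 0 <= M by apply: divr_ge0; [exact: addr_ge0|exact: ltW].
have M1 : 0 < M + 1 by lra.
have L1 : 0 < L + 1 by lra.
(* With [n] the distance of [y] to [x], the three radii give [n ^+ 2 <= n], [b x / 2 <= b y] and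
   [M * n <= e]; by the choice of [M] the last two put all second-order terms below
   [e * n * b y]. *)
exists (Num.min 1 (Num.min (b x / 2 / (L + 1)) (e / (M + 1)))).
  by rewrite !lt_min ltr01 !divr_gt0.
move=> y Dy; have by0 := Db y Dy.
have bKy := bK y; have aKy := aK y Dy.
have rb : r * b x = a x by rewrite /r divfK// gt_eqF.
have wd : dotv w (y - x) = dotv p (y - x) - r * dotv q (y - x).
  by rewrite /w dotvDl dotvNl dotvZl.
have wd2 := dotv_abs_le w (y - x).
have qd2 := dotv_abs_le q (y - x).
have d0 := norm2_ge0 (y - x).
rewrite dotvZl.
move: (norm2 (y - x)) (dotv w (y - x)) (dotv p (y - x)) (dotv q (y - x))
  bKy aKy wd wd2 qd2 d0 => n wd pd qd /andP[b1 b2] a1 wdE wd2 qd2 n0.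
rewrite !lt_min !ltr_pdivlMr// => /and3P[n1 nL nM].
have nn : n ^+ 2 <= n by rewrite expr2 ler_piMr// ltW.
have bdist : `|b x - b y| <= L * n.
  have : Kb * n ^+ 2 <= Kb * n by rewrite ler_wpM2l.
  by move: qd2; rewrite !ler_norml /L => /andP[? ?] ?; apply/andP; split; lra.
have by2 : b x / 2 <= b y.
  by have := le_trans (ler_norm _) bdist; nra.
have num : wd - K * n ^+ 2 <= a y - r * b y.
  have : r * (b y - b x - qd) <= r * (Kb * n ^+ 2) by rewrite ler_wpM2l.
  by rewrite wdE /K; lra.
have -> : a y / b y = r + (a y - r * b y) / b y by field; rewrite gt_eqF.
rewrite -addrA lerD2l ler_pdivlMr//; apply: le_trans num.
have -> : ((b x)^-1 * wd - e * n) * b y =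
   wd - wd * (b x - b y) / b x - e * n * b y by field; rewrite gt_eqF.
have h1 : - (wd * (b x - b y) / b x) <= norm2 w * L / b x * n ^+ 2.
  rewrite -mulNr [leRHS]mulrAC ler_pM2r ?invr_gt0//.
  rewrite (le_trans (ler_norm _))// normrN normrM.
  have -> : norm2 w * L * n ^+ 2 = norm2 w * n * (L * n) by ring.
  by rewrite ler_pM.
have h2 : (norm2 w * L / b x + K) * n ^+ 2 <= e * n * b y.
  have -> : norm2 w * L / b x + K = M * (b x / 2).
    by rewrite /M divfK// gt_eqF// divr_gt0.
  have h3 : M * n * (b x / 2) <= e * b y.
    have Mn : M * n <= e by lra.
    by apply: ler_pM => //; [exact: mulr_ge0|exact: ltW].
  have : n * (M * n * (b x / 2)) <= n * (e * b y) by rewrite ler_wpM2l.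
  by rewrite expr2; lra.
by lra.
Qed.

End tangent.

Section compactness.
Variable R : realType.

Lemma norm_trmx_le m n (z : 'M[R]_(m, n)) : `|z^T| <= `|z|.
Proof.
rewrite [leLHS]/Num.Def.normr/= mx_normrE; apply/bigmax_leP; split=> //.
move=> [i j] _; rewrite /= mxE [leRHS]/Num.Def.normr/= mx_normrE.
exact: (le_bigmax_cond _ (fun ij => `|z ij.1 ij.2|) (j := (j, i))).
Qed.

Lemma continuous_trmx m n : continuous (@trmx R m n).
Proof.
move=> x P /nbhs_ballP[e e0 eP]; apply/nbhs_ballP; exists e => // y.
rewrite -ball_normE/= => xy; apply: eP; rewrite -ball_normE/= -linearB/=.
exact: le_lt_trans (norm_trmx_le _) xy.
Qed.

(** [bounded_closed_compact] is about row vectors; transposition carries it over to columns. *)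
Lemma compact_cV n (D : set 'cV[R]_n) B :
  (forall x, D x -> norm2 x <= B) -> closed D -> compact D.
Proof.
move=> DB Dc; have -> : D = @trmx R 1 n @` (@trmx R 1 n @^-1` D).
  apply/seteqP; split=> [x Dx|_ [y Dy <-]//].
  by exists x^T; rewrite /= ?trmxK.
apply: continuous_compact.
  exact/continuous_subspaceT/continuous_trmx.
apply: bounded_closed_compact; last first.
  by move/continuous_closedP : (@continuous_trmx 1 n); exact.
exists B; split; first exact: num_real.
move=> M BM y /= /DB yB; apply: (le_trans _ (ltW BM)); apply: le_trans yB.
rewrite (le_trans _ (norm_le_norm2 _))// -{1}(trmxK y).
exact: norm_trmx_le.
Qed.

Lemma sphere_compact n : compact (@sphere R n).
Proof.
apply: (@compact_cV _ _ 1) => [x ->//|x xcl].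
rewrite /sphere/=; apply/eqP; rewrite -subr_eq0 -normr_le0.
apply/ler_addgt0Pr => e e0; rewrite add0r.
have [] := xcl [set y | norm2 (y - x) < e]; first by apply/nbhs_norm2P; exists e.
move=> y [/= y1 /ltW yx]; apply: le_trans yx.
by rewrite -y1 distrC ler_dist_norm2.
Qed.

Lemma polyhedron_compact N M0 P (A : 'M[R]_(M0, N)) b (C : 'M[R]_(P, N)) d :
  bounded_set (polyhedron A b C d) -> compact (polyhedron A b C d).
Proof.
move=> [M [_ MB]].
apply: (@compact_cV _ _ (N%:R * (`|M| + 1))) => [x Dx|].
  rewrite (le_trans (norm2_le_norm _))// ler_wpM2l//.
  by apply: (MB (`|M| + 1)) => //; rewrite (le_lt_trans (ler_norm _))// ltrDl.
have half (a : 'cV[R]_N) c x : closure (polyhedron A b C d) x ->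
    (forall y, polyhedron A b C d y -> dotv a y <= c) -> dotv a x <= c.
  move=> xcl ac; rewrite leNgt; apply/negP => cax.
  have : dotv (- a) x < - c by rewrite dotvNl ltrN2.
  move=> /dotv_near_lt/xcl[y [/ac ay /=]].
  by rewrite dotvNl ltrN2 ltNge ay.
move=> x xcl; split=> [i|].
  rewrite mulmx_coord_dotv; apply: half xcl _ => y [Ay _].
  by rewrite -mulmx_coord_dotv.
apply/colP => i; apply/eqP; rewrite eq_le mulmx_coord_dotv; apply/andP; split.
  by apply: half xcl _ => y [_ <-]; rewrite -mulmx_coord_dotv.
rewrite -lerN2 -dotvNl; apply: half xcl _ => y [_ <-].
by rewrite dotvNl -mulmx_coord_dotv.
Qed.

End compactness.

Section smoothness.
Variable R : realType.

Lemma qform_tangent n (A : 'M[R]_n) x K : sym_posdef A ->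
  (forall x, qform A x <= K * norm2 x ^+ 2) ->
  tangent_bounds (qform A) x (2 *: (A *m x)) K.
Proof.
move=> [As Apos] AK y; set d := y - x; have -> : y = x + d by rewrite /d addrC subrK.
rewrite qformD// dotvZl.
have -> : qform A x + 2 * dotv (A *m x) d + qform A d - qform A x -
  2 * dotv (A *m x) d = qform A d by ring.
rewrite AK andbT; have [->|d0] := eqVneq d 0; last exact/ltW/Apos.
by rewrite qformE dotv0l.
Qed.

Lemma grad_qform n (A : 'M[R]_n) x : sym_posdef A ->
  grad (qform A) x = 2 *: (A *m x).
Proof.
move=> Apd; have [K _ KA] := qform_bound A.
apply: tangent_bounds_grad; apply: qform_tangent => // y.
exact: le_trans (ler_norm _) (KA y).
Qed.

(** Compared with the origin, the Lipschitz bound reads [2 * norm2 (A *m y) <= ell * norm2 y], and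
    the remainder over the tangent is the form itself. *)
Lemma qform_lipschitz_grad n (A : 'M[R]_n) ell : sym_posdef A ->
  lipschitz_grad (qform A) ell ->
  forall x, tangent_bounds (qform A) x (grad (qform A) x) (ell / 2).
Proof.
move=> Apd [ell0 lip] x; rewrite grad_qform//.
apply: qform_tangent => // y; have := lip y 0.
rewrite !grad_qform// mulmx0 scaler0 !subr0 norm2Z ger0_norm// => h.
rewrite qformE; apply: le_trans (dotv_le _ _) _.
by have := ler_wpM2r (norm2_ge0 y) h; rewrite expr2; lra.
Qed.

(** The remainder is [(norm2 x * norm2 y - dotv x y) / norm2 x]: nonnegative by Cauchy-Schwarz, with
    numerator [norm2 (y - x) ^+ 2 / 2] minus [(norm2 x - norm2 y) ^+ 2 / 2]. *)
Lemma norm2_tangent n (x : 'cV[R]_n) : x != 0 ->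
  tangent_bounds (@norm2 R n) x ((norm2 x)^-1 *: x) (2 * norm2 x)^-1.
Proof.
move=> x0 y; have xp : 0 < norm2 x by rewrite norm2_gt0.
rewrite dotvZl dotvDr dotvNr -norm2_sqr.
have -> : norm2 y - norm2 x - (norm2 x)^-1 * (dotv x y - norm2 x ^+ 2) =
  (norm2 x * norm2 y - dotv x y) / norm2 x by field; rewrite gt_eqF.
apply/andP; split; first by rewrite divr_ge0 ?norm2_ge0// subr_ge0 dotv_le.
have yx : norm2 (y - x) ^+ 2 = norm2 y ^+ 2 - 2 * dotv x y + norm2 x ^+ 2.
  by rewrite [LHS]norm2_sqr !dotv_lin -!norm2_sqr (dotvC y x); ring.
rewrite yx ler_pdivrMr//.
have -> : (2 * norm2 x)^-1 * (norm2 y ^+ 2 - 2 * dotv x y + norm2 x ^+ 2)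
  * norm2 x = norm2 x * norm2 y - dotv x y + (norm2 x - norm2 y) ^+ 2 / 2.
  by field; rewrite gt_eqF.
by rewrite lerDl divr_ge0 ?sqr_ge0.
Qed.

Lemma grad_norm2 n (x : 'cV[R]_n) : x != 0 ->
  grad (@norm2 R n) x = (norm2 x)^-1 *: x.
Proof. by move=> /norm2_tangent/tangent_bounds_grad. Qed.

Lemma tangent_bounds_le n (f : 'cV[R]_n -> R) x p K K' :
  K <= K' -> tangent_bounds f x p K -> tangent_bounds f x p K'.
Proof.
move=> KK fK y; have /andP[-> h] := fK y; rewrite (le_trans h)//.
by rewrite ler_wpM2r ?sqr_ge0.
Qed.

Lemma grad_norm2_lip n (x y : 'cV[R]_n) m :
  0 < m -> m <= norm2 x -> m <= norm2 y ->
  norm2 (grad (@norm2 R n) x - grad (@norm2 R n) y) <= 2 / m * norm2 (x - y).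
Proof.
move=> m0 mx my.
have xp : 0 < norm2 x by exact: lt_le_trans mx.
have yp : 0 < norm2 y by exact: lt_le_trans my.
rewrite !grad_norm2 -?norm2_gt0//.
have -> : (norm2 x)^-1 *: x - (norm2 y)^-1 *: y =
  (norm2 x)^-1 *: (x - y) + ((norm2 x)^-1 * (norm2 y - norm2 x)) *: ((norm2 y)^-1 *: y).
  apply/colP => i; rewrite !mxE; field; rewrite !gt_eqF//.
rewrite (le_trans (ler_norm2D _ _))// !norm2Z normrM !normfV !(ger0_norm (norm2_ge0 _)).
rewrite mulVf ?gt_eqF// mulr1 -mulrDr.
have h1 : `|norm2 y - norm2 x| <= norm2 (x - y) by rewrite distrC ler_dist_norm2.
apply: (@le_trans _ _ (m^-1 * (norm2 (x - y) + norm2 (x - y)))).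
  by rewrite ler_pM ?invr_ge0 ?addr_ge0 ?norm2_ge0// ?lef_pV2 ?posrE// lerD2l.
by rewrite le_eqVlt; apply/orP; left; apply/eqP; ring.
Qed.

Lemma norm1_lip n (x y : 'cV[R]_n) :
  `|norm1 x - norm1 y| <= n%:R * norm2 (x - y).
Proof.
have half (a b : 'cV[R]_n) : norm1 a - norm1 b <= n%:R * norm2 (a - b).
  apply: le_trans (norm1_le_norm2 _); rewrite lerBlDr.
  by have := ler_norm1D (a - b) b; rewrite subrK.
rewrite ler_norml half andbT.
by have := half y x; rewrite (norm2B y x); lra.
Qed.

Lemma norm1_subgradient n (x y : 'cV[R]_n) :
  norm1 x + dotv (\col_i Num.sg (x i 0)) (y - x) <= norm1 y.
Proof.
rewrite dotvE -big_split/=; apply: ler_sum => i _; rewrite !mxE.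
have := ler_norm (y i 0); have := ler_norm (- y i 0); rewrite normrN.
have [xi|xi|->] := ltrgt0P (x i 0).
- by rewrite gtr0_sg//; lra.
- by rewrite ltr0_sg//; lra.
- by rewrite sgr0; lra.
Qed.

End smoothness.

(** The lower limit bounds a tail by [tb / 2]; the finitely many earlier terms have a positive
    minimum. *)
Lemma limn_einf_gt0_bound (R : realType) (t : nat -> R) (tb : R) :
  limn_einf (fun n => (t n)%:E) = tb%:E -> 0 < tb -> (forall n, 0 < t n) ->
  exists2 a, 0 < a & forall n, a <= t n.
Proof.
move=> tlim tb0 t0.
have : ((tb / 2)%:E < limn_einf (fun n => (t n)%:E))%E.
  by rewrite tlim lte_fin ltr_pdivrMr//; lra.
rewrite -[limn_einf _]/(limf_einf (fun n => (t n)%:E) \oo) limf_einfE.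
move=> /ereal_sup_gt[_ [V [n0 _ n0V] <-] /ltW Vt].
have tn n : (n0 <= n)%N -> tb / 2 <= t n.
  move=> nn0; rewrite -lee_fin (le_trans Vt)//; apply: ereal_inf_lbound.
  by exists n => //; exact: n0V.
have [a a0 at_] : exists2 a, 0 < a & forall n, (n < n0)%N -> a <= t n.
  elim: (n0) => [|k [a a0 ak]]; first by exists 1.
  exists (Num.min a (t k)); first by rewrite lt_min a0 t0.
  by move=> n; rewrite ltnS leq_eqVlt ge_min => /predU1P[->|/ak ->//]; rewrite lexx orbT.
exists (Num.min a (tb / 2)) => [|n]; first by rewrite lt_min a0 divr_gt0.
rewrite ge_min; have [n0n|nn0] := leqP n0 n; first by rewrite (tn n)// orbT.
by rewrite at_.
Qed.

(** * Linear convergence of e-PSG *)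

Section rate.
Variable R : realType.

(* A point of D where r differs from r0 has a neighborhood which x_ eventually
   leaves, so the near-covering form of compactness only needs the KL inequality
   at points with value r0. *)
Lemma uniform_KL N (D : set 'cV[R]_N) (r : 'cV[R]_N -> R)
    (x_ v_ : nat -> 'cV[R]_N) (r0 : R) :
  compact D ->
  (forall x e, D x -> 0 < e -> exists2 rho, 0 < rho & forall y, D y ->
    norm2 (y - x) < rho -> `|r y - r x| < e) ->
  (forall xb, D xb -> exists2 K, 0 < K & exists2 rho, 0 < rho & forall x v,
    norm2 (x - xb) < rho -> regular_subgradient r D x v ->
    r x - r xb <= K * norm2 v ^+ 2) ->
  (forall n, regular_subgradient r D (x_ n) (v_ n)) ->
  r (x_ n) @[n --> \oo] --> r0 ->
  exists2 K, 0 < K &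
    \forall n \near \oo, r (x_ n) - r0 <= K * norm2 (v_ n) ^+ 2.
Proof.
move=> /compact_near_coveringP Dc rc KL rv rx.
(* The parameter of the covering is a pair of an index and a constant, both going to infinity. The
   guard [x_ nK.1 = x] turns a statement on the points of [D] into one on the sequence. *)
pose P (nK : nat * R) (x : 'cV[R]_N) := x_ nK.1 = x ->
  r x - r0 <= nK.2 * norm2 (v_ nK.1) ^+ 2.
have : \forall nK \near (filter_prod \oo (pinfty_nbhs R)), D `<=` P nK.
  apply: Dc => xb Dxb.
  have [rxb|rxb] := eqVneq (r xb) r0.
    have [K K0 [rho rho0 KLrho]] := KL _ Dxb.
    exists ([set x | norm2 (x - xb) < rho],
      [set nK : nat * R | K < nK.2]) => /=.
      split; first by apply/nbhs_norm2P; exists rho.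
      exists (setT, [set k : R | K < k]); last by move=> [n k] [].
      by split => /=; [exact: filterT|exists K; split => //; exact: num_real].
    move=> [x [n k]] /= [xxb kK] xn.
    have := KLrho _ (v_ n) xxb; rewrite -{1}xn rxb => /(_ (rv n)) h.
    by rewrite (le_trans h)// ler_wpM2r ?sqr_ge0// ltW.
  have e0 : 0 < `|r0 - r xb| / 2.
    by rewrite divr_gt0// normr_gt0 subr_eq0 eq_sym.
  have [rho rho0 rrho] := rc _ _ Dxb e0.
  exists ([set x | norm2 (x - xb) < rho],
    [set nK : nat * R | `|r0 - r (x_ nK.1)| < `|r0 - r xb| / 2]) => /=.
    split; first by apply/nbhs_norm2P; exists rho.
    exists ([set n | `|r0 - r (x_ n)| < `|r0 - r xb| / 2], setT);
      last by move=> [n k] [].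
    by split => /=; [move/cvgrPdist_lt : rx; exact|exact: filterT].
  move=> [x [n k]] /= [xxb nr] xn; exfalso.
  have [Dx _] := rv n; rewrite xn in Dx nr.
  have := rrho x Dx xxb; have := ler_distD (r x) r0 (r xb); lra.
move=> [[A B] /= [[n0 _ nA] [M [_ MB]]] AB].
exists (`|M| + 1); first by rewrite ltr_wpDl.
exists n0 => // n n0n; have [Dxn _] := rv n.
apply: (AB (n, `|M| + 1) _ _ Dxn erefl); split => /=; first exact: nA.
by apply: MB; rewrite (le_lt_trans (ler_norm _))// ltrDl.
Qed.

Lemma two_step_linear_rate (E : nat -> R) (q : R) n0 :
  (forall n, 0 <= E n) -> (forall n, E n.+1 <= E n) -> 0 < q < 1 ->
  (forall n, (n0 <= n)%N -> E n.+2 <= q * E n) ->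
  exists gamma rho, [/\ 0 < gamma, 0 < rho < 1 &
    forall n, E n <= gamma * rho ^+ n].
Proof.
move=> E0 Edec /andP[q0 q1] Eq.
have EE n k : E (n + k)%N <= E n.
  by elim: k => [|k IH]; rewrite ?addn0// addnS (le_trans (Edec _)).
pose rho := Num.sqrt q.
have rho0 : 0 < rho by rewrite sqrtr_gt0.
have rho1 : rho < 1 by rewrite -sqrtr1 ltr_sqrt.
have rho2 : rho ^+ 2 = q by rewrite sqr_sqrtr// ltW.
(* The divisor makes the bound follow from [E n <= E 0] up to [n0.+1]; beyond, going back two
   indices stays at [n0] or above, where [Eq] applies. *)
exists ((E 0%N + 1) / rho ^+ n0.+1), rho; split; last 1 first.
- move=> n; have [k] := ubnP n; elim: k n => // k IH n; rewrite ltnS => nk.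
  have [nn0|nn0] := leqP n n0.+1.
    have : rho ^+ n0.+1 <= rho ^+ n by rewrite ler_wiXn2l ?ltW.
    move=> h; rewrite mulrAC ler_pdivlMr ?exprn_gt0//.
    rewrite ler_pM// ?exprn_ge0 ?ltW//.
    by have := EE 0%N n; rewrite add0n; lra.
  case: n nk nn0 => [|[|n]]// nk nn0.
  rewrite (le_trans (Eq _ _))// -rho2.
  have := IH n (ltn_trans (ltnSn _) nk).
  rewrite -(ler_pM2l (exprn_gt0 2 rho0)) => /le_trans; apply.
  by rewrite mulrCA -exprD add2n.
- by rewrite divr_gt0 ?exprn_gt0// ltr_wpDl.
- by rewrite rho0.
Qed.

Lemma geometric_steps_limit N (D : set 'cV[R]_N) (x_ : nat -> 'cV[R]_N) a s :
  compact D -> (forall n, D (x_ n)) -> 0 < s < 1 ->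
  (forall n, norm2 (x_ n.+1 - x_ n) <= a * s ^+ n) ->
  exists2 x, D x & x_ n @[n --> \oo] --> x /\
    forall n, norm2 (x_ n - x) <= a / (1 - s) * s ^+ n.
Proof.
move=> Dc Dx /andP[s0 s1] xs.
have s1' : 0 < 1 - s by rewrite subr_gt0.
have a0 : 0 <= a by have := xs 0%N; rewrite expr0 mulr1; exact/le_trans/norm2_ge0.
(* Keeping the exact partial sum, with [s ^+ (n + k)] subtracted, lets the induction on [k]
   close. *)
have xk n k : norm2 (x_ (n + k)%N - x_ n) <= a / (1 - s) * (s ^+ n - s ^+ (n + k)).
  elim: k => [|k IH]; first by rewrite addn0 !subrr norm2_0 mulr0.
  have -> : x_ (n + k.+1)%N - x_ n =
      (x_ (n + k).+1 - x_ (n + k)%N) + (x_ (n + k)%N - x_ n).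
    by rewrite addnS addrA subrK.
  rewrite (le_trans (ler_norm2D _ _))//.
  have -> : a / (1 - s) * (s ^+ n - s ^+ (n + k.+1)) =
     a * s ^+ (n + k) + a / (1 - s) * (s ^+ n - s ^+ (n + k)).
    by rewrite addnS exprS; field; rewrite gt_eqF.
  by rewrite lerD.
(* Compactness provides a cluster point in [D]. Some [x_ k] with [k] beyond [n] is arbitrarily close
   to it, so [xk] gives the rate and hence convergence. *)
have [x [Dxx xcl]] : D `&` cluster (x_ n @[n --> \oo]) !=set0.
  by apply: Dc; exists 0%N => // n _ /=; exact: Dx.
have bound n : norm2 (x_ n - x) <= a / (1 - s) * s ^+ n.
  apply/ler_addgt0Pr => e e0.
  have [] := xcl (x_ @` [set k | (n <= k)%N]) [set y | norm2 (y - x) < e].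
  - by exists n => // k nk; exists k.
  - by apply/nbhs_norm2P; exists e.
  move=> _ [[k /= nk <-] /ltW xe].
  have -> : x_ n - x = - (x_ k - x_ n) + (x_ k - x) by rewrite opprB addrA subrK.
  rewrite (le_trans (ler_norm2D _ _))// norm2N lerD//.
  rewrite -(subnKC nk) (le_trans (xk _ _))//.
  apply: ler_wpM2l; first by rewrite divr_ge0// ltW.
  by rewrite gerBl exprn_ge0// ltW.
exists x => //; split=> //; apply/cvg_norm2P.
apply: (@squeeze_cvgr _ _ _ _ (fun=> 0) (fun n => a / (1 - s) * s ^+ n)).
- by apply: nearW => n; rewrite norm2_ge0 bound.
- exact: cvg_cst.
rewrite -[X in _ --> X](mulr0 (a / (1 - s))); apply: cvgMr.
by apply: cvg_expr; rewrite gtr0_norm.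
Qed.

End rate.

Definition real_objective (R : realType) (N : nat) (fs fn : 'cV[R]_N -> R)
    (ell tau theta : R) (u v gr x : 'cV[R]_N) : R :=
  fn x + (fs u + dotv (grad fs u) (x - u)
    + (2 * tau)^-1 * norm2 (x - v - (tau * theta) *: gr) ^+ 2
    + ell / 2 * norm2 (x - u) ^+ 2).

Section epsg.
Variables (R : realType) (N : nat) (D : set 'cV[R]_N).
Variables (fr fs fn g : 'cV[R]_N -> R).
Variables (ell m M delta mubar kappabar taumin Lf Kg Gg Lg : R).
Variables (tau kappa mu : nat -> R) (x_ : nat -> 'cV[R]_N).

Let r x := fr x / g x.
Let dx n := x_ n - x_ n.-1.
Let u n := x_ n + kappa n *: dx n.
Let v n := x_ n + mu n *: dx n.
Let obj n := real_objective fs fn ell (tau n) (r (x_ n)) (u n) (v n)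
  (grad g (x_ n)).
Let c := ell * kappabar ^+ 2 / (2 * m) + mubar / (2 * Num.sqrt (m * M)).
Let H n := r (x_ n) + c * norm2 (dx n) ^+ 2.

Hypothesis Lf_ge0 : 0 <= Lf.
Hypothesis Lg_ge0 : 0 <= Lg.
Hypothesis D_compact : compact D.
Hypothesis m_gt0 : 0 < m.
Hypothesis M_gt0 : 0 < M.
Hypothesis ell_ge0 : 0 <= ell.
Hypothesis frE : forall x, D x -> fr x = fs x + fn x.
Hypothesis fr_ge0 : forall x, D x -> 0 <= fr x.
Hypothesis fr_lip : forall x y, D x -> D y ->
  `|fr x - fr y| <= Lf * norm2 (x - y).
Hypothesis g_bounds : forall x, D x -> m <= g x <= M.
Hypothesis Kg_ge0 : 0 <= Kg.
Hypothesis g_tangent : forall x, D x -> tangent_bounds g x (grad g x) Kg.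
Hypothesis grad_g_le : forall x, D x -> norm2 (grad g x) <= Gg.
Hypothesis grad_g_lip : forall x y, D x -> D y ->
  norm2 (grad g x - grad g y) <= Lg * norm2 (x - y).
Hypothesis fs_tangent : forall x, tangent_bounds fs x (grad fs x) (ell / 2).
Hypothesis grad_fs_lip : forall x y,
  norm2 (grad fs x - grad fs y) <= ell * norm2 (x - y).
Hypothesis KL : forall xb, D xb ->
  exists2 K, 0 < K & exists2 rho, 0 < rho & forall x v,
    norm2 (x - xb) < rho -> regular_subgradient r D x v ->
    r x - r xb <= K * norm2 v ^+ 2.
Hypothesis params : ePSG_parameters ell m M delta mubar kappabar.
Hypothesis x_D : forall n, D (x_ n).
Hypothesis taumin_gt0 : 0 < taumin.
Hypothesis tau_ge : forall n, taumin <= tau n.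
Hypothesis tau_le : forall n, tau n <= delta^-1.
Hypothesis kappa_bounds : forall n, 0 <= kappa n <= kappabar.
Hypothesis mu_bounds : forall n, 0 <= mu n <= mubar * tau n.
Hypothesis x_min : forall n y, D y -> obj n (x_ n.+1) <= obj n y.

Let tau_gt0 n : 0 < tau n.
Proof. exact: lt_le_trans (tau_ge n). Qed.

(** The gradient at [x_ n.+1] of the smooth part of the subproblem. *)
Let q n := grad fs (u n) + (tau n)^-1 *: (x_ n.+1 - v n)
  - r (x_ n) *: grad g (x_ n) + ell *: (x_ n.+1 - u n).

(** The smooth part is a quadratic polynomial, so its expansion at [x_ n.+1] is exact. This stands
    for the optimality condition, and covers the nonconvex [fn] of the sphere. *)
Lemma epsg_minimizer n y : D y ->
  fn (x_ n.+1) <= fn y + dotv (q n) (y - x_ n.+1)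
    + ((2 * tau n)^-1 + ell / 2) * norm2 (y - x_ n.+1) ^+ 2.
Proof.
move=> Dy; have := x_min n Dy; rewrite /obj /real_objective /q.
set x := x_ n.+1; set e := y - x.
have -> : y - u n = (x - u n) + e by rewrite /e [RHS]addrC addrA subrK.
have -> : y - v n - (tau n * r (x_ n)) *: grad g (x_ n) =
    (x - v n - (tau n * r (x_ n)) *: grad g (x_ n)) + e.
  by apply/colP => i; rewrite /e !mxE; ring.
move: (x - u n) (x - v n) (grad g (x_ n)) (grad fs (u n)) (r (x_ n)) => a b gr gs th.
clearbody e; rewrite !norm2_sqr !dotv_lin (dotvC e a) (dotvC e b) (dotvC e gr).
have t0 := tau_gt0 n.
move=> h; rewrite -subr_ge0 in h; rewrite -subr_ge0; apply: le_trans h _.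
rewrite le_eqVlt; apply/orP; left; apply/eqP.
by field; rewrite gt_eqF.
Qed.

Let s := Num.sqrt (m * M).
(** The first two terms are the gain from the new step; [c] is the part of it spent on the proximal
    term of [H n.+1]. *)
Let eps := delta / (2 * M) - mubar / (2 * s) - c.

Lemma epsg_sqrtP : 0 < s /\ s ^+ 2 = m * M.
Proof.
by split; [rewrite sqrtr_gt0 mulr_gt0|rewrite sqr_sqrtr// ltW// mulr_gt0].
Qed.

Lemma epsg_signs : [/\ 0 < delta, 0 <= mubar & 0 <= kappabar].
Proof. by have [? /andP[? _] ? _] := params. Qed.

(** The parameter ranges are made for this: if [0 < ell], [eps] is [ell / (2 * m)] times the gap
    between [kappabar ^+ 2] and its upper bound; if [ell = 0], it is
    [delta / (2 * M) - mubar / s]. *)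
Lemma epsg_eps_gt0 : 0 < eps.
Proof.
have [d0 /andP[mu0 mu1] k0 kell] := params.
have [s0 s2] := epsg_sqrtP.
rewrite -/s in mu1 kell.
have muM : mubar / s < delta / (2 * M).
  by rewrite ltr_pdivrMr// mulrAC.
rewrite /eps /c -/s.
have [ell0|ell0] := eqVneq ell 0.
  rewrite ell0 !mul0r add0r.
  have -> : mubar / (2 * s) = mubar / s / 2 by rewrite invfM; ring.
  by lra.
have ellp : 0 < ell by rewrite lt_neqAle eq_sym ell0.
have := kell ellp; set Y := _ - _ => kY.
(* [Num.sqrt] is 0 on negative numbers, so [0 <= kappabar < Num.sqrt Y] forces [0 < Y]. *)
have Y0 : 0 < Y by rewrite -sqrtr_gt0 (le_lt_trans _ kY).
have k2 : kappabar ^+ 2 < Y.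
  by rewrite -[ltRHS]sqr_sqrtr ?ltW// ltr_sqr ?nnegrE ?sqrtr_ge0.
have -> : delta / (2 * M) - mubar / (2 * s) -
    (ell * kappabar ^+ 2 / (2 * m) + mubar / (2 * s)) =
   (Y - kappabar ^+ 2) * (ell / (2 * m)).
  by rewrite /Y; field; rewrite !gt_eqF.
by rewrite mulr_gt0 ?subr_gt0// divr_gt0// mulr_gt0.
Qed.

Lemma epsg_c_ge0 : 0 <= c.
Proof.
have [_ mu0 k0] := epsg_signs; have [s0 _] := epsg_sqrtP.
rewrite /c -/s; apply: addr_ge0; apply: divr_ge0 => //.
- by rewrite mulr_ge0// sqr_ge0.
- by rewrite mulr_ge0// ltW.
- by rewrite mulr_ge0// ltW.
Qed.

(** Compare [x_ n.+1] with [x_ n] in the subproblem, use the tangent of [fs] at [u n] at both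
    points, bound the linear term in [grad g] by convexity of [g], and divide by [g (x_ n.+1)]. *)
Lemma epsg_descent n : H n.+1 + eps * norm2 (dx n.+1) ^+ 2 <= H n.
Proof.
have [d0 mu0 k0] := epsg_signs; have [s0 s2] := epsg_sqrtP.
have t0 := tau_gt0 n.
have Dn := x_D n; have Dn1 := x_D n.+1.
have /andP[gm gM] := g_bounds Dn1.
have /andP[gm' _] := g_bounds Dn.
have g0 : 0 < g (x_ n.+1) by exact: lt_le_trans gm.
have gn0 : 0 < g (x_ n) by exact: lt_le_trans gm'.
have th0 : 0 <= r (x_ n) by rewrite divr_ge0 ?fr_ge0// ltW.
have dE : x_ n.+1 = x_ n + dx n.+1 by rewrite /dx/= addrC subrK.
have h1 := epsg_minimizer n Dn.
have /andP[_ h2] := fs_tangent (u n) (x_ n.+1).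
have /andP[h3 _] := fs_tangent (u n) (x_ n).
have /andP[h4 _] := g_tangent Dn (x_ n.+1).
have h5 : fr (x_ n) = r (x_ n) * g (x_ n) by rewrite /r divfK// gt_eqF.
have /andP[ka0 ka1] := kappa_bounds n.
have /andP[mn0 mn1] := mu_bounds n.
have e1 : x_ n - x_ n.+1 = - dx n.+1 by rewrite /dx/= opprB.
have e2 : x_ n.+1 - x_ n = dx n.+1 by [].
have e3 : x_ n.+1 - u n = dx n.+1 - kappa n *: dx n.
  by rewrite /u opprD addrA.
have e4 : x_ n - u n = - (kappa n *: dx n).
  by rewrite /u opprD addrA subrr add0r.
have e5 : x_ n.+1 - v n = dx n.+1 - mu n *: dx n.
  by rewrite /v opprD addrA.
rewrite e2 in h4; rewrite e3 in h2; rewrite e4 in h3.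
rewrite /q e1 e3 e5 in h1.
have f1 := frE Dn; have f2 := frE Dn1.
have key : fr (x_ n.+1) <= r (x_ n) * g (x_ n.+1)
   + ell / 2 * kappa n ^+ 2 * norm2 (dx n) ^+ 2
   - (2 * tau n)^-1 * norm2 (dx n.+1) ^+ 2
   + mu n / tau n * dotv (dx n.+1) (dx n).
  have h6 : r (x_ n) * dotv (grad g (x_ n)) (dx n.+1) <=
      r (x_ n) * (g (x_ n.+1) - g (x_ n)) by rewrite ler_wpM2l//; lra.
  rewrite f2; rewrite f1 in h5.
  move: h1 h2 h3 h6.
  move: (dx n.+1) (dx n) (grad g (x_ n)) (grad fs (u n)) => a b gr gs.
  rewrite !norm2_sqr !dotv_lin (dotvC b a).
  have -> : (2 * tau n)^-1 = (tau n)^-1 / 2 by field; rewrite gt_eqF.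
  by move: (tau n)^-1 => ti; lra.
have ti1 : delta <= (tau n)^-1.
  by rewrite -[delta]invrK lef_pV2 ?posrE ?invr_gt0.
have t2E : (2 * tau n)^-1 = (tau n)^-1 / 2 by field; rewrite gt_eqF.
have mt : 0 <= mu n / tau n <= mubar.
  by rewrite ler_pdivrMr// mn1 divr_ge0// ltW.
have kk : kappa n ^+ 2 <= kappabar ^+ 2 by rewrite ler_sqr ?nnegrE.
have hd := dotv_le (dx n.+1) (dx n).
have a0 := norm2_ge0 (dx n.+1); have b0 := norm2_ge0 (dx n).
rewrite t2E in key.
(* Dividing by [g] will turn [P1] into [P1 / m] and [P2] into [P2 / M]. The Young weights
   [m / (2 * s)] and [M / (2 * s)] make the inertial term contribute [mubar / (2 * s)] to both,
   whence the geometric mean [s]. *)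
set P1 := ell * kappabar ^+ 2 / 2 + mubar * m / (2 * s).
set P2 := delta / 2 - mubar * M / (2 * s).
have key2 : fr (x_ n.+1) <= r (x_ n) * g (x_ n.+1)
   + P1 * norm2 (dx n) ^+ 2 - P2 * norm2 (dx n.+1) ^+ 2.
  apply: (le_trans key).
  move: (norm2 (dx n.+1)) (norm2 (dx n)) (dotv (dx n.+1) (dx n)) a0 b0 hd
    => a b ab a0 b0 hd.
  have k1 : ell / 2 * kappa n ^+ 2 * b ^+ 2 <= ell / 2 * kappabar ^+ 2 * b ^+ 2.
    by rewrite ler_wpM2r ?sqr_ge0// ler_wpM2l// divr_ge0.
  have k2 : delta / 2 * a ^+ 2 <= (tau n)^-1 / 2 * a ^+ 2.
    by rewrite ler_wpM2r ?sqr_ge0//; lra.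
  have k3 : mu n / tau n * ab <= mubar * (a * b).
    have /andP[mt0 mt1] := mt.
    rewrite (le_trans (ler_wpM2l mt0 hd))// ler_wpM2r// mulr_ge0//.
  have k4 : mubar * (a * b) <= mubar * (M / (2 * s) * a ^+ 2 + m / (2 * s) * b ^+ 2).
    rewrite ler_wpM2l//.
    (* (M a^2 + m b^2) / s - 2 a b = (M a - s b)^2 / (M s) *)
    rewrite -subr_ge0.
    have -> : M / (2 * s) * a ^+ 2 + m / (2 * s) * b ^+ 2 - a * b =
        (M * a - s * b) ^+ 2 / (2 * s * M).
      rewrite sqrrB [(s * b) ^+ 2]exprMn s2; field; rewrite !gt_eqF//.
    by rewrite divr_ge0 ?sqr_ge0// !mulr_ge0// ltW.
  by rewrite /P1 /P2; lra.
have P10 : 0 <= P1.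
  apply: addr_ge0; apply: divr_ge0; rewrite ?mulr_ge0 ?sqr_ge0//; exact: ltW.
have e0 := epsg_eps_gt0.
have c0 := epsg_c_ge0.
have cE : c = P1 / m by rewrite /c /P1 -/s; field; rewrite !gt_eqF.
have P2E : delta / (2 * M) - mubar / (2 * s) = P2 / M.
  by rewrite /P2; field; rewrite !gt_eqF.
have P20 : 0 <= P2.
  have : 0 < P2 / M by move: e0; rewrite /eps P2E; lra.
  by rewrite pmulr_lgt0 ?invr_gt0// => /ltW.
have : r (x_ n.+1) <= r (x_ n) + c * norm2 (dx n) ^+ 2 -
    (P2 / M) * norm2 (dx n.+1) ^+ 2.
  rewrite {1}/r ler_pdivrMr// (le_trans key2)// cE.
  have j1 : P1 * norm2 (dx n) ^+ 2 <= P1 / m * norm2 (dx n) ^+ 2 * g (x_ n.+1).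
    rewrite [leRHS]mulrAC ler_wpM2r ?sqr_ge0//.
    by rewrite -[leRHS]mulrA ler_peMr// mulrC ler_pdivlMr// mul1r.
  have j2 : P2 / M * norm2 (dx n.+1) ^+ 2 * g (x_ n.+1) <= P2 * norm2 (dx n.+1) ^+ 2.
    rewrite [leLHS]mulrAC ler_wpM2r ?sqr_ge0//.
    by rewrite -[leLHS]mulrA ler_piMr// mulrC ler_pdivrMr// mul1r.
  by move: j1 j2; move: (P1 / m) (P2 / M) => ? ?; lra.
rewrite /H /eps P2E; lra.
Qed.


Lemma epsg_g_gt0 x : D x -> 0 < g x.
Proof. by move=> /g_bounds/andP[gm _]; exact: lt_le_trans gm. Qed.

Lemma epsg_r_ge0 x : D x -> 0 <= r x.
Proof. by move=> Dx; rewrite divr_ge0 ?fr_ge0// ltW// epsg_g_gt0. Qed.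

Lemma epsg_g_lip x y : D x -> D y -> `|g x - g y| <= Gg * norm2 (x - y).
Proof.
move=> Dx Dy.
have half a b : D a -> D b -> g a - g b <= Gg * norm2 (a - b).
  move=> Da Db; have /andP[h _] := g_tangent Da b.
  have h1 := dotv_le (- grad g a) (b - a).
  rewrite norm2N dotvNl (norm2B b a) in h1.
  have : norm2 (grad g a) * norm2 (a - b) <= Gg * norm2 (a - b).
    by rewrite ler_wpM2r ?norm2_ge0// grad_g_le.
  by lra.
rewrite ler_norml half// andbT.
by have := half y x Dy Dx; rewrite (norm2B y x); lra.
Qed.

Lemma epsg_r_lip x y : D x -> D y ->
  `|r x - r y| <= (Lf + r y * Gg) / m * norm2 (x - y).
Proof.
move=> Dx Dy; have gx := epsg_g_gt0 Dx; have gy := epsg_g_gt0 Dy.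
have ry := epsg_r_ge0 Dy; have /andP[gm _] := g_bounds Dx.
have -> : r x - r y = ((fr x - fr y) + r y * (g y - g x)) / g x.
  by rewrite /r; field; rewrite !gt_eqF.
rewrite normrM normfV (gtr0_norm gx) ler_pdivrMr//.
have h : `|fr x - fr y + r y * (g y - g x)| <= (Lf + r y * Gg) * norm2 (x - y).
  rewrite (le_trans (ler_normD _ _))// mulrDl lerD ?fr_lip//.
  by rewrite normrM (ger0_norm ry) -mulrA ler_wpM2l// distrC epsg_g_lip.
apply: (le_trans h).
have h0 : 0 <= (Lf + r y * Gg) * norm2 (x - y) := le_trans (normr_ge0 _) h.
have -> : (Lf + r y * Gg) / m * norm2 (x - y) * g x =
  (Lf + r y * Gg) * norm2 (x - y) * (g x / m) by ring.
by rewrite ler_peMr// ler_pdivlMr// mul1r.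
Qed.

Lemma epsg_H_noninc n : H n.+1 <= H n.
Proof.
apply: le_trans (epsg_descent n).
by rewrite lerDl mulr_ge0 ?sqr_ge0// ltW// epsg_eps_gt0.
Qed.

Lemma epsg_H_ge n : r (x_ n) <= H n.
Proof. by rewrite lerDl mulr_ge0 ?sqr_ge0// epsg_c_ge0. Qed.

Lemma epsg_r_le n : r (x_ n) <= H 0.
Proof.
apply: le_trans (epsg_H_ge n) _.
by elim: n => // n; exact/le_trans/epsg_H_noninc.
Qed.

Lemma epsg_subgradient : exists2 C, 0 < C & forall n, exists2 w,
  regular_subgradient r D (x_ n.+1) w &
  norm2 w <= C * (norm2 (dx n.+1) + norm2 (dx n)).
Proof.
have [d0 mu0 k0] := epsg_signs.
have H00 : 0 <= H 0 := le_trans (epsg_r_ge0 (x_D 0)) (epsg_H_ge 0).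
have Gg0 : 0 <= Gg := le_trans (norm2_ge0 _) (grad_g_le (x_D 0)).
(* A Lipschitz constant of [r] along the iterates, whose values stay below [H 0]. [C1] and [C2]
   below are the factors of the last step and of the one before. *)
pose Lr := (Lf + H 0 * Gg) / m.
have Lr0 : 0 <= Lr by apply: divr_ge0; [rewrite addr_ge0 ?mulr_ge0|exact: ltW].
pose C1 := 2 * ell + taumin^-1 + H 0 * Lg + Lr * Gg.
pose C2 := 2 * ell * kappabar + mubar.
have ti0 : 0 < taumin^-1 by rewrite invr_gt0.
have C10 : 0 < C1.
  have := mulr_ge0 H00 Lg_ge0; have := mulr_ge0 Lr0 Gg0.
  by rewrite /C1; have := ell_ge0; lra.
have C20 : 0 <= C2 by apply: addr_ge0; rewrite ?mulr_ge0.
exists ((C1 + C2) / m); first by rewrite divr_gt0// ltr_pwDl.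
move=> n; have Dn := x_D n; have Dn1 := x_D n.+1.
have g0 := epsg_g_gt0 Dn1; have /andP[gm _] := g_bounds Dn1.
have t0 := tau_gt0 n.
(* [epsg_minimizer] and the tangent of [fs] make [p] a proximal subgradient of [fr] at [x_ n.+1];
   the quotient rule then gives [w]. *)
pose p := grad fs (x_ n.+1) - q n.
have Kt : 0 <= (2 * tau n)^-1 + ell / 2.
  by rewrite addr_ge0 ?divr_ge0// invr_ge0 mulr_ge0// ltW.
have h1 y : D y -> fr (x_ n.+1) + dotv p (y - x_ n.+1) -
    ((2 * tau n)^-1 + ell / 2) * norm2 (y - x_ n.+1) ^+ 2 <= fr y.
  move=> Dy; have := epsg_minimizer n Dy.
  have /andP[fs1 _] := fs_tangent (x_ n.+1) y.
  by rewrite /p dotvDl dotvNl !frE//; lra.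
eexists.
  exact: (regular_subgradient_div Dn1 epsg_g_gt0 (fr_ge0 Dn1) Kt Kg_ge0 h1
    (g_tangent Dn1)).
rewrite -/(r (x_ n.+1)) norm2Z gtr0_norm ?invr_gt0//.
have /andP[ka0 ka1] := kappa_bounds n.
have /andP[mn0 mn1] := mu_bounds n.
set A := norm2 (dx n.+1); set B := norm2 (dx n).
have A0 : 0 <= A by exact: norm2_ge0.
have B0 : 0 <= B by exact: norm2_ge0.
have xu : norm2 (x_ n.+1 - u n) <= A + kappabar * B.
  have -> : x_ n.+1 - u n = dx n.+1 - kappa n *: dx n.
    by rewrite /u opprD addrA.
  rewrite (le_trans (ler_norm2B _ _))// lerD2l norm2Z ger0_norm//.
  by rewrite ler_wpM2r.
have xv : (tau n)^-1 * norm2 (x_ n.+1 - v n) <= taumin^-1 * A + mubar * B.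
  have -> : x_ n.+1 - v n = dx n.+1 - mu n *: dx n.
    by rewrite /v opprD addrA.
  apply: (@le_trans _ _ ((tau n)^-1 * (A + mu n * B))).
    rewrite ler_pM2l ?invr_gt0//.
    by rewrite (le_trans (ler_norm2B _ _))// lerD2l norm2Z ger0_norm.
  rewrite mulrDr lerD//.
    by rewrite ler_wpM2r// lef_pV2 ?posrE.
  by rewrite mulrA ler_wpM2r// mulrC ler_pdivrMr.
have th : norm2 (r (x_ n) *: grad g (x_ n) - r (x_ n.+1) *: grad g (x_ n.+1))
    <= (H 0 * Lg + Lr * Gg) * A.
  have -> : r (x_ n) *: grad g (x_ n) - r (x_ n.+1) *: grad g (x_ n.+1) =
      r (x_ n) *: (grad g (x_ n) - grad g (x_ n.+1)) +
      (r (x_ n) - r (x_ n.+1)) *: grad g (x_ n.+1).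
    by rewrite scalerBr scalerBl addrA subrK.
  rewrite (le_trans (ler_norm2D _ _))// mulrDl lerD//.
    rewrite norm2Z ger0_norm ?epsg_r_ge0// -mulrA.
    rewrite ler_pM ?norm2_ge0 ?epsg_r_ge0 ?epsg_r_le//.
    by rewrite /A /dx/= (norm2B (x_ n.+1)) grad_g_lip.
  rewrite norm2Z mulrAC ler_pM ?norm2_ge0 ?grad_g_le//.
  rewrite (le_trans (epsg_r_lip Dn Dn1))// (norm2B (x_ n)) -/A ler_wpM2r//.
  by rewrite ler_pM2r ?invr_gt0// lerD2l ler_wpM2r// epsg_r_le.
(* Regrouped this way, only differences of nearby quantities remain, each controlled by the two
   steps. *)
have wE : p - r (x_ n.+1) *: grad g (x_ n.+1) =
    (grad fs (x_ n.+1) - grad fs (u n)) - (tau n)^-1 *: (x_ n.+1 - v n)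
    - ell *: (x_ n.+1 - u n)
    + (r (x_ n) *: grad g (x_ n) - r (x_ n.+1) *: grad g (x_ n.+1)).
  rewrite /p /q; move: (grad _ _) (grad _ _) (grad _ _) (grad _ _) => a b e f.
  by apply/colP => i; rewrite !mxE; ring.
have fsu := grad_fs_lip (x_ n.+1) (u n).
have wn : norm2 (p - r (x_ n.+1) *: grad g (x_ n.+1)) <= C1 * A + C2 * B.
  rewrite wE (le_trans (ler_norm2D _ _))//.
  have := ler_norm2B (grad fs (x_ n.+1) - grad fs (u n)
    - (tau n)^-1 *: (x_ n.+1 - v n)) (ell *: (x_ n.+1 - u n)).
  have := ler_norm2B (grad fs (x_ n.+1) - grad fs (u n))
    ((tau n)^-1 *: (x_ n.+1 - v n)).
  rewrite !norm2Z (ger0_norm ell_ge0) gtr0_norm ?invr_gt0//.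
  have : ell * norm2 (x_ n.+1 - u n) <= ell * (A + kappabar * B).
    by rewrite ler_wpM2l.
  by rewrite /C1 /C2; lra.
rewrite mulrC ler_pdivrMr// (le_trans wn)//.
apply: (@le_trans _ _ ((C1 + C2) * (A + B))).
  by have := mulr_ge0 (ltW C10) B0; have := mulr_ge0 C20 A0; lra.
have -> : (C1 + C2) / m * (A + B) * g (x_ n.+1) =
  (C1 + C2) * (A + B) * (g (x_ n.+1) / m) by ring.
rewrite ler_peMr//; last by rewrite ler_pdivlMr// mul1r.
by apply: mulr_ge0; [exact: addr_ge0 (ltW C10) C20|exact: addr_ge0].
Qed.

Lemma epsg_r_continuous x e : D x -> 0 < e -> exists2 rho, 0 < rho &
  forall y, D y -> norm2 (y - x) < rho -> `|r y - r x| < e.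
Proof.
move=> Dx e0; set L := (Lf + r x * Gg) / m.
have L1 : 0 < `|L| + 1 by rewrite ltr_wpDl.
exists (e / (`|L| + 1)); first by rewrite divr_gt0.
move=> y Dy; rewrite ltr_pdivlMr// => yx.
apply: le_lt_trans (epsg_r_lip Dy Dx) _; rewrite -/L.
have := norm2_ge0 (y - x); have := ler_norm L; nra.
Qed.

Theorem epsg_linear_convergence : exists xinf,
  [/\ D xinf, x_ n @[n --> \oo] --> xinf &
   exists gamma1 gamma2 rho : R,
     [/\ 0 < gamma1, 0 < gamma2, 0 < rho < 1 & forall n,
       `|H n.+1 - r xinf| <= gamma1 * rho ^+ n /\
       norm2 (x_ n - xinf) <= gamma2 * rho `^ (n%:R / 2)]].
Proof.
have e0 := epsg_eps_gt0; have c0 := epsg_c_ge0.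
have H0 n : 0 <= H n := le_trans (epsg_r_ge0 (x_D n)) (epsg_H_ge n).
have Hdec : {homo H : n k / (n <= k)%N >-> k <= n}.
  by apply/nonincreasing_seqP; exact: epsg_H_noninc.
have /cvg_ex[/= h Hh] : cvgn H.
  by apply: nonincreasing_is_cvgn => //; exists 0 => _ [n _ <-].
have hH n : h <= H n.
  by rewrite -(cvg_lim _ Hh)//; apply: nonincreasing_cvgn_ge => //; exact: cvgP Hh.
have Hh1 : H n.+1 @[n --> \oo] --> h by rewrite -(cvg_shiftS H) in Hh.
have dH n : eps * norm2 (dx n.+1) ^+ 2 <= H n - H n.+1.
  by have := epsg_descent n; lra.
have dx0 : norm2 (dx n.+1) ^+ 2 @[n --> \oo] --> (0 : R).
  apply: (@squeeze_cvgr _ _ _ _ (fun=> 0) (fun n => eps^-1 * (H n - H n.+1))).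
  - apply: nearW => n; rewrite sqr_ge0/=.
    by rewrite mulrC ler_pdivlMr// mulrC.
  - exact: cvg_cst.
  by rewrite -(mulr0 eps^-1) -(subrr h); apply: cvgMr; exact: cvgB.
have rh : r (x_ n.+1) @[n --> \oo] --> h.
  have -> : (fun n => r (x_ n.+1)) = (fun n => H n.+1 - c * norm2 (dx n.+1) ^+ 2).
    by apply/funext => n; rewrite /H addrK.
  by rewrite -[h]subr0 -(mulr0 c); apply: cvgB => //; exact: cvgMr.
have [C C0 subg] := epsg_subgradient.
have /choice[w_ /all_and2[w_reg w_le]] : forall n, exists w,
    regular_subgradient r D (x_ n.+1) w /\
    norm2 w <= C * (norm2 (dx n.+1) + norm2 (dx n)).
  by move=> n; have [w] := subg n; exists w.
have [K K0 [n0 _ Kn0]] :=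
  uniform_KL D_compact epsg_r_continuous KL w_reg rh.
pose K1 := K * (2 * C ^+ 2) + c.
have K10 : 0 < K1 by rewrite ltr_pwDl// !mulr_gt0// exprn_gt0.
have eK0 : 0 < eps + K1 := addr_gt0 e0 K10.
(* KL bounds [H n.+2 - h] by [K1] times the sum of two squared steps, and the descent bounds [eps]
   times that sum by [H n - H n.+2]; eliminating the sum gives the factor [K1 / (eps + K1)]. *)
have E2 n : (n0 <= n)%N -> H n.+2 - h <= K1 / (eps + K1) * (H n - h).
  move=> nn0; have := Kn0 n.+1 (leqW nn0); rewrite /= => h1.
  have w2 : norm2 (w_ n.+1) ^+ 2 <=
      2 * C ^+ 2 * (norm2 (dx n.+2) ^+ 2 + norm2 (dx n.+1) ^+ 2).
    apply: (@le_trans _ _ ((C * (norm2 (dx n.+2) + norm2 (dx n.+1))) ^+ 2)).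
      by rewrite ler_sqr ?nnegrE ?mulr_ge0 ?addr_ge0 ?norm2_ge0// ltW.
    rewrite exprMn [2 * C ^+ 2]mulrC -[leRHS]mulrA ler_wpM2l ?sqr_ge0//.
    by have := sqr_ge0 (norm2 (dx n.+2) - norm2 (dx n.+1)); lra.
  have h2 : H n.+2 - h <= K1 * (norm2 (dx n.+2) ^+ 2 + norm2 (dx n.+1) ^+ 2).
    have := ler_wpM2l (ltW K0) w2.
    have := mulr_ge0 c0 (sqr_ge0 (norm2 (dx n.+1))).
    rewrite /H /K1; lra.
  have h3 : eps * (norm2 (dx n.+2) ^+ 2 + norm2 (dx n.+1) ^+ 2) <= H n - H n.+2.
    by have := dH n; have := dH n.+1; lra.
  rewrite mulrAC ler_pdivlMr ?eK0//.
  have := ler_wpM2l (ltW K10) h3; have := ler_wpM2l (ltW e0) h2; lra.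
have [||//|gamma [rho [g0 /andP[rho0 rho1] gP]]] :=
    @two_step_linear_rate R (fun n => H n - h) (K1 / (eps + K1)) n0 _ _ _ E2.
- by move=> n; rewrite subr_ge0.
- by move=> n; rewrite lerD2r; exact: Hdec.
- rewrite divr_gt0 ?eK0//= ltr_pdivrMr ?eK0// mul1r.
  by rewrite ltrDr.
pose s1 := Num.sqrt rho.
have s10 : 0 < s1 by rewrite sqrtr_gt0.
have s11 : s1 < 1 by rewrite -sqrtr1 ltr_sqrt.
(* From [eps * norm2 (dx n.+1) ^+ 2 <= H n - h <= gamma * rho ^+ n]; the square root is the source
   of the exponent [n / 2]. *)
pose a := Num.sqrt (gamma / eps).
have a0 : 0 < a by rewrite sqrtr_gt0 divr_gt0.
have steps n : norm2 (x_ n.+1 - x_ n) <= a * s1 ^+ n.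
  rewrite -ler_sqr ?nnegrE ?norm2_ge0 ?mulr_ge0 ?exprn_ge0 ?(ltW a0) ?(ltW s10)//.
  rewrite exprMn -exprM mulnC exprM.
  rewrite (sqr_sqrtr (ltW rho0)) (sqr_sqrtr (ltW (divr_gt0 g0 e0))).
  rewrite mulrAC ler_pdivlMr// mulrC (le_trans (dH n))//.
  by have := gP n; have := hH n.+1; lra.
have [|xinf Dinf [xx xn]] := geometric_steps_limit D_compact x_D _ steps.
  by rewrite s10.
have rinf : r xinf = h.
  have rxinf : r (x_ n.+1) @[n --> \oo] --> r xinf.
    apply/cvgrPdist_lt => e e1.
    have [d d0 dP] := epsg_r_continuous Dinf e1.
    have : nbhs xinf [set y | norm2 (y - xinf) < d] by apply/nbhs_norm2P; exists d.
    move=> /xx [n1 _ n1P]; exists n1 => // n /= n1n.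
    by rewrite distrC; apply: dP => //; apply: n1P => /=; exact: leqW.
  by apply: cvg_unique rxinf rh; exact: norm_hausdorff.
exists xinf; split => //; exists gamma, (a / (1 - s1)), rho; split => //.
- by rewrite divr_gt0// subr_gt0.
- by rewrite rho0.
move=> n; split.
  rewrite rinf ger0_norm ?subr_ge0//.
  by apply: le_trans (gP n); rewrite lerD2r; exact: Hdec.
apply: le_trans (xn n) _; rewrite /s1 -powR12_sqrt ?(ltW rho0)//.
by rewrite -powR_mulrn ?powR_ge0// -powRrM [_ * n%:R]mulrC.
Qed.

End epsg.

(** * From the real-valued setting to the extended-valued data *)

Section assembly.
Variables (R : realType) (N : nat).
Variables (f fn : 'cV[R]_N -> \bar R) (fs g : 'cV[R]_N -> R) (S : set 'cV[R]_N).
Variables (fr fnr : 'cV[R]_N -> R).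

Hypothesis f_fin : forall x, (S `&` dom f) x -> f x = (fr x)%:E.

Lemma merit_fin c x y : (S `&` dom f) x ->
  merit f g S c x y = (fr x / g x + c * norm2 (x - y) ^+ 2)%:E.
Proof.
move=> Dx; rewrite /merit mem_set// f_fin// /iota_ mem_set ?adde0//.
by case: Dx.
Qed.

Lemma merit_KL c xb v K rho :
  0 <= c -> (S `&` dom f) xb -> 0 < K -> 0 < rho ->
  (forall x w, norm2 (x - xb) < rho ->
    regular_subgradient (fun x => fr x / g x) (S `&` dom f) x w ->
    fr x / g x - fr xb / g xb <= K * norm2 w ^+ 2) ->
  regular_subgradient (fun x => fr x / g x) (S `&` dom f) xb v ->
  KL_property (on_col_mx (merit f g S c)) (col_mx xb xb) (1 / 2).
Proof.
move=> c0 Dxb K0 rho0 KL hv.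
apply: (KL_property_half c0 _ _ Dxb K0 rho0 KL); last by exists v.
- by move=> x y Dx; rewrite /on_col_mx col_mxKu col_mxKd merit_fin.
- by move=> x y Dx; rewrite /on_col_mx col_mxKu /merit memNset.
Qed.

Hypothesis fn_fin : forall x, (S `&` dom f) x -> fn x = (fnr x)%:E.
Hypothesis fn_inf : forall x, S x -> ~ (S `&` dom f) x -> fn x = +oo%E.

Lemma merit_linear_convergence ell m M delta mubar kappabar taubar
    tau kappa mu x_ Lf Kg Gg Lg :
  lipschitz_grad fs ell -> 0 < m -> 0 < M ->
  (forall x, (S `&` dom f) x -> m <= g x <= M) ->
  ePSG_parameters ell m M delta mubar kappabar ->
  ePSG_sequence f fs fn g S ell delta mubar kappabar tau kappa mu x_ ->
  limn_einf (fun n => (tau n)%:E) = taubar%:E -> 0 < taubar ->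
  0 <= Lf -> 0 <= Lg -> compact (S `&` dom f) ->
  (forall x, (S `&` dom f) x -> fr x = fs x + fnr x) ->
  (forall x, (S `&` dom f) x -> 0 <= fr x) ->
  (forall x y, (S `&` dom f) x -> (S `&` dom f) y ->
    `|fr x - fr y| <= Lf * norm2 (x - y)) ->
  0 <= Kg ->
  (forall x, (S `&` dom f) x -> tangent_bounds g x (grad g x) Kg) ->
  (forall x, (S `&` dom f) x -> norm2 (grad g x) <= Gg) ->
  (forall x y, (S `&` dom f) x -> (S `&` dom f) y ->
    norm2 (grad g x - grad g y) <= Lg * norm2 (x - y)) ->
  (forall x, tangent_bounds fs x (grad fs x) (ell / 2)) ->
  (forall xb, (S `&` dom f) xb ->
    exists2 K, 0 < K & exists2 rho, 0 < rho & forall x w,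
    norm2 (x - xb) < rho ->
    regular_subgradient (fun x => fr x / g x) (S `&` dom f) x w ->
    fr x / g x - fr xb / g xb <= K * norm2 w ^+ 2) ->
  let c := ell * kappabar ^+ 2 / (2 * m) + mubar / (2 * Num.sqrt (m * M)) in
  let h := merit f g S c in
  exists xinf : 'cV[R]_N,
    x_ n @[n --> \oo] --> xinf /\
    exists gamma1 gamma2 rho : R,
      [/\ 0 < gamma1, 0 < gamma2, 0 < rho < 1 &
        forall n : nat,
          (`|h (x_ n.+1) (x_ n) - h xinf xinf| <= (gamma1 * rho ^+ n)%:E)%E
          /\ norm2 (x_ n - xinf) <= gamma2 * rho `^ (n%:R / 2)].
Proof.
move=> [ell0 lip] m0 M0 gmM params [x0 seq] tlim tb0 Lf0 Lg0 Dc frE fr0 frL Kg0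
  gT gG gL fsT KL c h.
have [tmin tmin0 tge] : exists2 a, 0 < a & forall n, a <= tau n.
  apply: limn_einf_gt0_bound tlim tb0 _ => n.
  by have [/andP[]] := seq n.
have objE n x : (S `&` dom f) x ->
    ePSG_objective fs fn ell (tau n) (fine (f (x_ n)) / g (x_ n))
      (x_ n + kappa n *: (x_ n - x_ n.-1)) (x_ n + mu n *: (x_ n - x_ n.-1))
      (grad g (x_ n)) x \is a fin_num.
  by move=> Dx; rewrite /ePSG_objective fn_fin.
(* Off the domain the objective is [+oo], while it is finite at [x_ n], so a minimizer stays in the
   domain. *)
have xD n : (S `&` dom f) (x_ n).
  elim: n => // n Dn; have [_ _ _ [Sn1 nmin]] := seq n.
  apply: contrapT => ND; have := nmin _ (proj1 Dn).
  rewrite {1}/ePSG_objective (fn_inf Sn1 ND) addye// leye_eq => /eqP oo.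
  by have := objE n _ Dn; rewrite oo.
have xmin n y : (S `&` dom f) y ->
    let obj := real_objective fs fnr ell (tau n) (fr (x_ n) / g (x_ n))
      (x_ n + kappa n *: (x_ n - x_ n.-1)) (x_ n + mu n *: (x_ n - x_ n.-1))
      (grad g (x_ n)) in
    obj (x_ n.+1) <= obj y.
  move=> Dy; have [_ _ _ [_ nmin]] := seq n; have := nmin _ (proj1 Dy).
  by rewrite /ePSG_objective !fn_fin// f_fin.
have tle n : tau n <= delta^-1 by have [/andP[]] := seq n.
have kb n : 0 <= kappa n <= kappabar by have [] := seq n.
have mb n : 0 <= mu n <= mubar * tau n by have [] := seq n.
have [xinf [Dinf xx [g1 [g2 [rho [g10 g20 rho01 rate]]]]]] :=
  epsg_linear_convergence Lf0 Lg0 Dc m0 M0 ell0 frE fr0 frL gmM Kg0 gT gG gL fsT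
    lip KL params xD tmin0 tge tle kb mb xmin.
exists xinf; split=> //; exists g1, g2, rho; split => // n.
have [r1 r2] := rate n; split=> //.
by rewrite /h !merit_fin// subrr norm2_0 expr0n mulr0 addr0 -EFinB /= lee_fin.
Qed.

End assembly.

Section cases.
Variable R : realType.

Lemma quadratic_case_domain N (A : 'M[R]_N) :
  [set: 'cV[R]_N] `&`
    dom (fun x => ((qform A x)%:E + iota_ R (@sphere R N) x)%E)
  = @sphere R N.
Proof.
rewrite setTI; apply/seteqP; split=> x.
  rewrite /dom/= /iota_; case: ifPn => [/set_mem//|_].
  by rewrite addey// ltxx.
by move=> Sx; rewrite /dom/= /iota_ mem_set// adde0 ltry.
Qed.

Lemma sparse_case_domain N (S : set 'cV[R]_N) :
  S `&` dom (fun x => (norm1 x)%:E) = S.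
Proof.
by apply/seteqP; split=> [x []//|x Sx]; split => //; rewrite /dom/= ltry.
Qed.

End cases.

Theorem proposition5p7 (R : realType) (N : nat)
    (f : 'cV[R]_N -> \bar R) (fs : 'cV[R]_N -> R) (fn : 'cV[R]_N -> \bar R)
    (g : 'cV[R]_N -> R) (S : set 'cV[R]_N)
    (Hcase : quadratic_case f fs fn g S \/ sparse_case f fs fn g S) :
  (forall c : R, 0 <= c ->
   forall xbar : 'cV[R]_N, (S `&` dom f) xbar ->
     KL_property (on_col_mx (merit f g S c)) (col_mx xbar xbar) (1 / 2))
  /\
  (forall (ell m M delta mubar kappabar taubar : R)
          (tau kappa mu : nat -> R) (x_ : nat -> 'cV[R]_N),
     lipschitz_grad fs ell ->
     0 < m -> 0 < M ->
     (forall x, (S `&` dom f) x -> m <= g x <= M) ->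
     ePSG_parameters ell m M delta mubar kappabar ->
     ePSG_sequence f fs fn g S ell delta mubar kappabar tau kappa mu x_ ->
     limn_einf (fun n => (tau n)%:E) = taubar%:E -> 0 < taubar ->
     let c := ell * kappabar ^+ 2 / (2 * m) + mubar / (2 * Num.sqrt (m * M)) in
     let h := merit f g S c in
     exists xinf : 'cV[R]_N,
       x_ n @[n --> \oo] --> xinf /\
       exists gamma1 gamma2 rho : R,
         [/\ 0 < gamma1, 0 < gamma2, 0 < rho < 1 &
           forall n : nat,
             (`|h (x_ n.+1) (x_ n) - h xinf xinf| <= (gamma1 * rho ^+ n)%:E)%E
             /\ norm2 (x_ n - xinf) <= gamma2 * rho `^ (n%:R / 2)]).
Proof.
case: Hcase => [[A [B [Apd [Bpd [fE -> fnE -> ->]]]]]|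
  [M0 [P [A [b [C [d [[fE -> fnE -> SE] [S_ne S_bnd S_0]]]]]]]]].
- have DE : [set: 'cV[R]_N] `&` dom f = @sphere R N.
    by rewrite fE quadratic_case_domain.
  have f_fin x : ([set: 'cV[R]_N] `&` dom f) x -> f x = (qform A x)%:E.
    by rewrite DE fE => Dx; rewrite /iota_ mem_set// adde0.
  have KL xb : sphere xb -> exists2 K, 0 < K & exists2 rho, 0 < rho &
      forall x v, norm2 (x - xb) < rho ->
      regular_subgradient (fun x => qform A x / qform B x) (@sphere R N) x v ->
      qform A x / qform B x - qform A xb / qform B xb <= K * norm2 v ^+ 2.
    exact: (quadratic_KL (proj1 Apd) Bpd).
  have neq0 (x : 'cV[R]_N) : sphere x -> x != 0.
    by move=> x1; rewrite -norm2_gt0 x1.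
  have Apos x : sphere x -> 0 < qform A x by move=> /neq0/(proj2 Apd).
  have Bpos x : sphere x -> 0 < qform B x by move=> /neq0/(proj2 Bpd).
  have [KA KA0 KAP] := qform_bound A; have [KB KB0 KBP] := qform_bound B.
  have [LA LA0 LAP] := mulmx_norm2_bound A.
  have [LB LB0 LBP] := mulmx_norm2_bound B.
  have qB x : qform B x <= KB * norm2 x ^+ 2 := le_trans (ler_norm _) (KBP x).
  have qA x : qform A x <= KA * norm2 x ^+ 2 := le_trans (ler_norm _) (KAP x).
  have tB x : tangent_bounds (qform B) x (grad (qform B) x) KB.
    by rewrite grad_qform//; exact: qform_tangent.
  split=> [c c0 xb Dxb|].
    rewrite DE in Dxb; have [K K0 [rho rho0 KLP]] := KL xb Dxb.
    apply: (merit_KL f_fin c0 _ K0 rho0); rewrite DE//.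
    (* [qform A] is convex, so its gradient serves with [Ka = 0]. *)
    apply: (regular_subgradient_div (p := 2 *: (A *m xb)) Dxb Bpos
      (ltW (Apos _ Dxb)) (lexx 0) (ltW KB0) _ (tB xb)).
    move=> y _; have /andP[h _] := qform_tangent xb Apd qA y.
    by lra.
  move=> ell m M delta mubar kappabar taubar tau kappa mu x_ lip m0 M0 gmM params
    seq tlim tb0.
  apply: (merit_linear_convergence (fr := qform A) (fnr := fun=> 0)
    (Lf := 2 * LA + 2 * KA) (Kg := KB) (Gg := 2 * LB) (Lg := 2 * LB)
    f_fin _ _ lip m0 M0 gmM params seq tlim tb0) => //; rewrite ?DE.
  + by move=> x Dx; rewrite fnE /iota_ mem_set.
  + by move=> x _ NDx; rewrite fnE /iota_ memNset.
  + by rewrite addr_ge0// mulr_ge0// ltW.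
  + by rewrite mulr_ge0// ltW.
  + exact: sphere_compact.
  + by move=> x _; rewrite addr0.
  + by move=> x /Apos/ltW.
  (* Points of the sphere are at distance at most 2, which turns the quadratic remainder into a
     Lipschitz term. *)
  + move=> x y Dx Dy; set e := x - y.
    have -> : x = y + e by rewrite /e addrC subrK.
    have e2 : norm2 e <= 2 by rewrite (le_trans (ler_norm2B _ _))// Dx Dy.
    rewrite qformD ?(proj1 Apd)//.
    have -> : qform A y + 2 * dotv (A *m y) e + qform A e - qform A y =
       2 * dotv (A *m y) e + qform A e by ring.
    rewrite (le_trans (ler_normD _ _))// [leRHS]mulrDl lerD//.
      rewrite normrM ger0_norm// -mulrA ler_wpM2l//.
      rewrite (le_trans (dotv_abs_le _ _))// ler_wpM2r ?norm2_ge0//.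
      by rewrite (le_trans (LAP _))// Dy mulr1.
    rewrite (le_trans (KAP _))// [2 * KA]mulrC -mulrA ler_pM2l// expr2.
    by rewrite ler_wpM2r ?norm2_ge0.
  + exact: ltW.
  + move=> x Dx; rewrite grad_qform// norm2Z ger0_norm// ler_wpM2l//.
    by rewrite (le_trans (LBP _))// Dx mulr1.
  + move=> x y _ _; rewrite !grad_qform// -scalerBr -mulmxBr norm2Z ger0_norm//.
    by rewrite -mulrA ler_wpM2l.
  + exact: qform_lipschitz_grad.
  + exact: KL.
have DE : S `&` dom f = S by rewrite fE sparse_case_domain.
have S_E : S = polyhedron A b C d by rewrite SE.
have f_fin x : (S `&` dom f) x -> f x = (norm1 x)%:E by rewrite fE.
have neq0 x : S x -> x != 0 by apply: contraPneq => ->.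
have npos x : S x -> 0 < norm2 x by move=> /neq0; rewrite norm2_gt0.
have KL xb : S xb -> exists2 K, 0 < K & exists2 rho, 0 < rho &
    forall x v, norm2 (x - xb) < rho ->
    regular_subgradient (fun x => norm1 x / norm2 x) S x v ->
    norm1 x / norm2 x - norm1 xb / norm2 xb <= K * norm2 v ^+ 2.
  by move: S_0; rewrite S_E => S_0; exact: l1_l2_ratio_KL.
have n1_ge0 (x : 'cV[R]_N) : 0 <= norm1 x by exact: sumr_ge0.
split=> [c c0 xb Dxb|].
  rewrite DE in Dxb; have [K K0 [rho rho0 KLP]] := KL xb Dxb.
  apply: (merit_KL f_fin c0 _ K0 rho0); rewrite DE//.
  have h0 : 0 <= (2 * norm2 xb)^-1 by rewrite invr_ge0 mulr_ge0 ?norm2_ge0.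
  (* The sign vector is a subgradient of the l1 norm, again with [Ka = 0]. *)
  apply: (regular_subgradient_div (p := \col_i Num.sg (xb i 0)) Dxb npos
    (n1_ge0 xb) (lexx 0) h0 _ (norm2_tangent (neq0 _ Dxb))).
  by move=> y _; rewrite mul0r subr0 norm1_subgradient.
move=> ell m M delta mubar kappabar taubar tau kappa mu x_ lip m0 M0' gmM params
  seq tlim tb0.
have ms x : S x -> m <= norm2 x by rewrite -{1}DE => /gmM/andP[].
have [ell0 _] := lip.
have t0 (x : 'cV[R]_N) K : 0 <= K -> tangent_bounds (fun=> 0) x 0 K.
  by move=> K0 y; rewrite dotv0l !subr0 lexx mulr_ge0 ?sqr_ge0.
have grad0 (x : 'cV[R]_N) : grad (fun=> 0) x = 0.
  exact: tangent_bounds_grad (t0 x 0 (lexx 0)).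
apply: (merit_linear_convergence (fr := @norm1 R N) (fnr := @norm1 R N)
  (Lf := N%:R) (Kg := (2 * m)^-1) (Gg := 1) (Lg := 2 / m)
  f_fin _ _ lip m0 M0' gmM params seq tlim tb0) => //; rewrite ?DE.
+ by move=> x _; rewrite fnE.
+ by move=> x Sx.
+ by rewrite divr_ge0// ltW.
+ by rewrite S_E; apply: polyhedron_compact; rewrite -S_E.
+ by move=> x _; rewrite add0r.
+ by move=> x y _ _; exact: norm1_lip.
+ by rewrite invr_ge0 mulr_ge0// ltW.
+ move=> x Sx; rewrite grad_norm2 ?neq0//.
  apply: tangent_bounds_le (norm2_tangent (neq0 _ Sx)).
  by rewrite lef_pV2 ?posrE ?mulr_gt0 ?npos// ler_pM2l// ms.
+ move=> x Sx; rewrite grad_norm2 ?neq0// norm2Z normfV ger0_norm ?norm2_ge0//.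
  by rewrite mulVf// gt_eqF// npos.
+ by move=> x y Sx Sy; rewrite grad_norm2_lip ?ms.
+ by move=> x; rewrite grad0; apply: t0; rewrite divr_ge0.
+ exact: KL.
Qed.
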